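(* Let $\kappa$ be a singular (uncountable) cardinal with $2^{<\kappa}=\kappa$, and let $X$ be a nonempty regular Hausdorff space of weight at most $\kappa$ such that every open subset of $X$ is a union of at most $\operatorname{cof}(\kappa)$-many closed sets (i.e. $\kappa\text{-}\boldsymbol{\Sigma}^0_1(X)\subseteq\operatorname{cof}(\kappa)^+\text{-}\boldsymbol{\Sigma}^0_2(X)$). Then for every $\alpha<\kappa^+$, the following conditions (1)–(6) are equivalent: (1) $\operatorname{ord}_\kappa(X)\le1+\alpha$; (2) for every $\beta\ge\alpha$, $\kappa\text{-}\boldsymbol{\Sigma}^0_{1+\beta}(X)=\kappa\text{-}\boldsymbol{\Pi}^0_{1+\beta}(X)=\kappa\text{-}\boldsymbol{\Delta}^0_{1+\beta}(X)=\kappa\text{-}\mathbf{Bor}(X)$; (3) for some $\beta>\alpha$, one of $\kappa\text{-}\boldsymbol{\Sigma}^0_{1+\alpha}(X)$, $\kappa\text{-}\boldsymbol{\Pi}^0_{1+\alpha}(X)$, or $\kappa\text{-}\boldsymbol{\Delta}^0_{1+\alpha}(X)$ coincides with one of $\kappa\text{-}\boldsymbol{\Sigma}^0_{1+\beta}(X)$ or $\kappa\text{-}\boldsymbol{\Pi}^0_{1+\beta}(X)$; (4) the class $\kappa\text{-}\boldsymbol{\Sigma}^0_{1+\alpha}(X)$ is closed under intersections of size $\kappa$ (equivalently, $\kappa\text{-}\boldsymbol{\Pi}^0_{1+\alpha}(X)$ is closed under unions of size $\kappa$); (5) the class $\kappa\text{-}\boldsymbol{\Sigma}^0_{1+\alpha}(X)$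 is closed under intersections shorter than $\kappa$ (equivalently, $\kappa\text{-}\boldsymbol{\Pi}^0_{1+\alpha}(X)$ is closed under unions shorter than $\kappa$); (6) for some $\beta>\alpha$, one of $\kappa\text{-}\boldsymbol{\Sigma}^0_{1+\alpha}(X)$, $\kappa\text{-}\boldsymbol{\Pi}^0_{1+\alpha}(X)$, or $\kappa\text{-}\boldsymbol{\Delta}^0_{1+\alpha}(X)$ coincides with $\kappa\text{-}\boldsymbol{\Delta}^0_{1+\beta}(X)$. Moreover, if $\alpha\ge1$, conditions (1)–(6) are also equivalent to each of the following two conditions: (7) the class $\kappa\text{-}\boldsymbol{\Delta}^0_{1+\alpha}(X)$ is closed under intersections of size $\kappa$, and hence it is a $\kappa^+$-algebra; (8) the class $\kappa\text{-}\boldsymbol{\Delta}^0_{1+\alpha}(X)$ is closed under intersections shorter than $\kappa$, and hence it is a $\kappa$-algebra. If instead $\alpha$ is even, then conditions (1)–(6) are also equivalent to the following one: (9) $\kappa\text{-}\boldsymbol{\Sigma}^0_{1+\alpha}$ is selfdual on $X$, i.e. $\kappa\text{-}\boldsymbol{\Sigma}^0_{1+\alpha}(X)=\kappa\text{-}\boldsymbol{\Pi}^0_{1+\alpha}(X)$.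
   Context: For a topological space $X$ and an ordinal $\gamma>\omega$, define by recursion on ordinals $\alpha\ge 1$: $\gamma\text{-}\boldsymbol{\Sigma}^0_1(X)$ is the family of open sets; for $\alpha>1$, $\gamma\text{-}\boldsymbol{\Sigma}^0_\alpha(X)$ is the family of all unions $\bigcup_{\xi<\delta}A_\xi$ with $\delta<\gamma$ and each $A_\xi\in\bigcup_{1\le\beta<\alpha}\gamma\text{-}\boldsymbol{\Pi}^0_\beta(X)$; $\gamma\text{-}\boldsymbol{\Pi}^0_\alpha(X)$ is the family of complements of sets in $\gamma\text{-}\boldsymbol{\Sigma}^0_\alpha(X)$; $\gamma\text{-}\boldsymbol{\Delta}^0_\alpha(X)=\gamma\text{-}\boldsymbol{\Sigma}^0_\alpha(X)\cap\gamma\text{-}\boldsymbol{\Pi}^0_\alpha(X)$. A $\gamma$-algebra on $X$ is a family of subsets of $X$ closed under complements and well-ordered unions of length less than $\gamma$, and $\gamma\text{-}\mathbf{Bor}(X)$ is the smallest $\gamma$-algebra on $X$ containing the open sets. The order is $\operatorname{ord}_\gamma(X)=\min\{\alpha\in\mathrm{Ord}\mid\gamma\text{-}\boldsymbol{\Sigma}^0_\alpha(X)=\gamma\text{-}\mathbf{Bor}(X)\}$. Every ordinal $\alpha$ is written uniquely as $\alpha=\lambda+n$ with $n<\omega$ and $\lambda=0$ or $\lambda$ limit; $\alpha$ is even (odd) if $n$ is even (odd). *)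

(* Defs.v *)
From mathcomp Require Import all_boot.
From mathcomp Require Import boolp classical_sets functions cardinality wochoice.
From mathcomp Require Import topology.

Set Implicit Arguments.
Unset Strict Implicit.
Unset Printing Implicit Defensive.

Local Open Scope classical_set_scope.
Local Open Scope card_scope.

(* An ordinal is a well-ordered type, compared through initial-segment
   embeddings. Everything below is invariant under isomorphism ([eqO]), and
   [[set: a]] stands for the set of ordinals less than [a]. The name
   [ordinal] is already MathComp's type of bounded natural numbers. *)
Record Ord := MkOrd {
  carrier :> Type;
  wle : rel carrier;
  wle_wo : well_order wle
}.
Arguments wle {o} : rename.

Definition leO (a b : Ord) : Prop :=
  exists2 f : a -> b,
    {mono f : x y / wle x y} & forall x y, wle y (f x) -> exists z, f z = y.
Definition ltO (a b : Ord) : Prop := leO a b /\ ~ leO b a.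
Definition eqO (a b : Ord) : Prop := leO a b /\ leO b a.

Declare Scope ord_scope.
Delimit Scope ord_scope with ord.
Notation "a <=o b" := (leO a b) (at level 70, no associativity) : ord_scope.
Notation "a <o b" := (ltO a b) (at level 70, no associativity) : ord_scope.
Local Open Scope ord_scope.

Lemma nat_wo (T : Type) (f : T -> nat) : injective f ->
  well_order (fun x y : T => f x <= f y).
Proof.
move=> f_inj; apply: antisymmetric_well_order.
  by move=> x y /anti_leq /f_inj.
move=> A [x Ax].
have exA : exists n, `[< exists2 y, y \in A & f y = n >].
  by exists (f x); apply/asboolP; exists x.
case: (ex_minnP exA) => n /asboolP[y Ay <-] miny.
by exists y; split=> // z Az; apply: miny; apply/asboolP; exists z.
Qed.

Definition natO (n : nat) : Ord := MkOrd (@nat_wo 'I_n _ val_inj).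
Definition omegaO : Ord := MkOrd (@nat_wo nat id (fun _ _ => id)).

Definition sum_le (a b : Ord) : rel (a + b) := fun u v =>
  match u, v with
  | inl x, inl y => wle x y
  | inl _, inr _ => true
  | inr _, inl _ => false
  | inr x, inr y => wle x y
  end.

Lemma sum_le_wo (a b : Ord) : well_order (@sum_le a b).
Proof.
move=> A [u Au].
have [[x Ax]|noL] := pselect (exists x, inl x \in A).
  have [|z [[Az minz] uniqz]] := @wle_wo a [pred x | inl x \in A].
    by exists x.
  exists (inl z); split; first by split=> // -[y|y] // Ay; apply: minz.
  move=> [y|y] [Ay miny]; last by have := miny _ Az.
  by congr inl; apply: uniqz; split=> // t At; apply: (miny (inl t)).
case: u Au => [x Ax|x Ax]; first by case: noL; exists x.
have [|z [[Az minz] uniqz]] := @wle_wo b [pred x | inr x \in A].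
  by exists x.
exists (inr z); split.
  by split=> // -[y Ay|y Ay]; [case: noL; exists y | apply: minz].
move=> [y|y] [Ay miny]; first by case: noL; exists y.
by congr inr; apply: uniqz; split=> // t At; apply: (miny (inr t)).
Qed.

Definition addO (a b : Ord) : Ord := MkOrd (@sum_le_wo a b).
Notation "a +o b" := (addO a b) (at level 50, left associativity) : ord_scope.

Definition limitO (a : Ord) : Prop :=
  natO 0 <o a /\ forall b, b <o a -> b +o natO 1 <o a.

Definition evenO (a : Ord) : Prop := exists (l : Ord) (n : nat),
  [/\ eqO l (natO 0) \/ limitO l, ~~ odd n & eqO a (l +o natO n)].

Definition is_least (P : Ord -> Prop) (a : Ord) : Prop :=
  P a /\ forall b, P b -> a <=o b.

(* The least ordinal satisfying [P], determined up to isomorphism; [natO 0] if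
   [P] is empty. *)
Definition least (P : Ord -> Prop) : Ord :=
  if pselect (exists a, is_least P a) is left ex then projT1 (cid ex)
  else natO 0.

(* Cardinals are initial ordinals. *)
Definition cardinal (k : Ord) : Prop :=
  forall b, b <o k -> ~ ([set: k] #<= [set: b]).

Definition succ_card (k : Ord) : Ord := least (fun n => cardinal n /\ k <o n).

Definition cof (k : Ord) : Ord :=
  least (fun d => exists f : d -> k, forall x, exists i, wle x (f i)).

Definition singular_cardinal (k : Ord) : Prop :=
  [/\ cardinal k, omegaO <o k & cof k <o k].

(* 2^{<k}, i.e. the supremum of the cardinals 2^l for l a cardinal below k. *)
Definition pow2_lt (k : Ord) : Ord :=
  least (fun n => cardinal n /\
    forall l, cardinal l -> l <o k -> [set: set l] #<= [set: n]).

Definition weight_le (X : topologicalType) (k : Ord) : Prop :=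
  exists2 B : set (set X), B #<= [set: k] & basis B.

Section Borel.
Variables (g : Ord) (X : topologicalType).

(* The recursion on the rank is rendered as an inductive predicate: every
   premise of the second clause has a strictly smaller rank, and the two
   clauses apply to disjoint ranks. The premise on [~` A i] says that [A i]
   is in the class Pi of rank [b i]. There is no set of rank 0. *)
Inductive Sigma : Ord -> set X -> Prop :=
| Sigma_open (a : Ord) (U : set X) : eqO a (natO 1) -> open U -> Sigma a U
| Sigma_bigcup (a d : Ord) (b : d -> Ord) (A : d -> set X) :
    natO 1 <o a -> d <o g ->
    (forall i, natO 1 <=o b i) -> (forall i, b i <o a) ->
    (forall i, Sigma (b i) (~` A i)) ->
    Sigma a (\bigcup_i A i).

Definition Pi (a : Ord) : set (set X) := [set A | Sigma a (~` A)].

Definition Delta (a : Ord) : set (set X) := Sigma a `&` Pi a.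

Definition bigcup_closed (d : Ord) (C : set (set X)) : Prop :=
  forall A : d -> set X, (forall i, C (A i)) -> C (\bigcup_i A i).

Definition bigcap_closed (d : Ord) (C : set (set X)) : Prop :=
  forall A : d -> set X, (forall i, C (A i)) -> C (\bigcap_i A i).

Definition gamma_algebra (C : set (set X)) : Prop :=
  (forall A, C A -> C (~` A)) /\ forall d, d <o g -> bigcup_closed d C.

Definition Bor : set (set X) := smallest gamma_algebra open.

Definition borel_order : Ord :=
  least (fun a => natO 1 <=o a /\ Sigma a = Bor).

End Borel.

Arguments Sigma : clear implicits.
Arguments Pi : clear implicits.
Arguments Delta : clear implicits.
Arguments Bor : clear implicits.
Arguments borel_order : clear implicits.
Arguments gamma_algebra g {X} C.
Arguments bigcup_closed {X} d C.
Arguments bigcap_closed {X} d C.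

(* Main.v *)
Require Import Defs.
From mathcomp Require Import all_boot.
From mathcomp Require Import boolp classical_sets functions cardinality wochoice.
From mathcomp Require Import topology.

Set Implicit Arguments.
Unset Strict Implicit.
Unset Printing Implicit Defensive.

Local Open Scope classical_set_scope.
Local Open Scope card_scope.
Local Open Scope ord_scope.


(** Everything follows from a parity phenomenon. Write [k] for the cardinal
    and call small what has cardinality less than [k]. By König's inequality a
    singular [k] with 2^{<k} = k is a strong limit ([small_set]), so function
    spaces between small types are small, and the distributive law turns small
    unions of small intersections into small intersections of small unions and
    back, as long as the numbers of pieces have a common small bound.

    Open sets are unions of cofinality many closed sets. Starting from there,
    induction on the rank shows that ranks of two kinds alternate. At rank 0,
    at limits and two steps after a rank of the same kind, the class Sigma is
    closed under small unions, and a fixed small number of members of the dual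
    class suffices to make up each of its sets ([even_like]). One step later
    distributivity makes Sigma selfdual ([selfdual_succ]), and two steps later
    Sigma consists of the unions of [k] members of the dual class of the rank
    that one started from ([Sig_succ_succ]). Limit ranks are of the first kind
    because a limit ordinal below the successor of [k] has small cofinality.

    Given this, a union of [k] sets being a union of cofinality many small
    unions, the implications are formal except for the one from (6) to (1).
    There Sigma is selfdual at the given rank and contains every ambiguous set
    of the next rank. At a rank of the first kind closure under small unions
    makes it an algebra. The remaining case is [card_union_collapse]: let [P]
    be the dual class one rank below, so that small unions of members of [P]
    form the class of the given rank, unions of [k] members that of the next
    one, and suppose that a set is a small union as soon as both it and its
    complement are unions of [k] members; then all these unions are small.

    To see this, call a set null when every union of [k] members of [P]
    inside it is a small union. If small unions are chosen inside the members
    of a small disjoint family, their union is ambiguous, hence a small union,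
    and therefore one small bound on the number of pieces serves them all
    ([uniform_disjoint]). It follows that null sets are closed under small
    unions, and that there are never cofinality many disjoint nonnull sets,
    since inside those one could choose sets needing more and more pieces. On
    the other hand some basic open set splits a given nonnull set into two
    nonnull parts: otherwise, deleting all null traces of basic open sets
    would leave at most one point ([nonnull_split]). Suppose that the whole
    space is not null, and split it repeatedly, cofinality many times. There
    are fewer than [k] cells, so some point lies in no null cell; the halves
    split off along the way to that point are disjoint and nonnull, and there
    are cofinality many of them, a contradiction ([null_setT]). *)

(** * Well-orders and the comparison of ordinals *)

Definition wlt (o : Ord) (x y : o) : bool := ~~ wle y x.

Section WellOrder.
Variable o : Ord.
Implicit Types x y z : o.

Lemma wle_min (P : o -> Prop) :
  (exists x, P x) -> exists x, P x /\ forall y, P y -> wle x y.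
Proof.
move=> [x Px]; have [|z [[Pz minz] _]] := @wle_wo o [pred x | `[< P x >]].
  by exists x; apply/asboolP.
by exists z; split=> [|y Py]; [exact/asboolP | apply/minz/asboolP].
Qed.

Lemma wle_total x y : wle x y || wle y x.
Proof.
have [|z [[->|->] zP]] := @wle_min (fun z => z = x \/ z = y).
- by exists x; left.
- by rewrite (zP y) //; right.
- by rewrite (zP x) ?orbT //; left.
Qed.

Lemma wle_refl x : wle x x.
Proof. by rewrite -[wle x x]orbb wle_total. Qed.

Lemma wle_anti x y : wle x y -> wle y x -> x = y.
Proof.
move=> xy yx.
have [|z [_ uz]] := @wle_wo o [pred z | `[< z = x \/ z = y >]].
  by exists x; apply/asboolP; left.
have minP t : t = x \/ t = y -> minimum_of wle [pred z | `[< z = x \/ z = y >]] t.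
  move=> txy; split=> [|u /asboolP uxy]; first exact/asboolP.
  by move: txy uxy => [->|->] [->|->] //; apply: wle_refl.
by rewrite -(uz x (minP x (or_introl erefl))) (uz y (minP y (or_intror erefl))).
Qed.

Lemma wle_trans y x z : wle x y -> wle y z -> wle x z.
Proof.
move=> xy yz.
have [|t [[->|[->|->]] tP]] := @wle_min (fun t => t = x \/ t = y \/ t = z).
- by exists x; left.
- by apply: tP; tauto.
- by have -> // : x = y; apply: wle_anti => //; apply: tP; tauto.
- by rewrite -(@wle_anti y z) //; apply: tP; tauto.
Qed.

Lemma wltNge x y : wlt x y = ~~ wle y x. Proof. by []. Qed.
Lemma wleNgt x y : wle x y = ~~ wlt y x. Proof. by rewrite /wlt negbK. Qed.

Lemma wltW x y : wlt x y -> wle x y.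
Proof. by rewrite wltNge; case/orP: (wle_total x y) => ->. Qed.

Lemma wle_lt_trans y x z : wle x y -> wlt y z -> wlt x z.
Proof. by move=> xy; apply: contra => zx; apply: wle_trans xy. Qed.

Lemma wlt_le_trans y x z : wlt x y -> wle y z -> wlt x z.
Proof. by move=> xy yz; apply: contra xy => zx; apply: wle_trans zx. Qed.

Lemma wle_eqVlt x y : wle x y -> x = y \/ wlt x y.
Proof.
by move=> xy; have [yx|] := boolP (wle y x); [left; apply: wle_anti | right].
Qed.

Lemma wlt_neq x y : x <> y -> wlt x y \/ wlt y x.
Proof.
move=> xy; case/orP: (wle_total x y) => /wle_eqVlt[e|lt]; try by [left|right].
by case: xy.
Qed.

Lemma wlt_ind (P : o -> Prop) :
  (forall x, (forall y, wlt y x -> P y) -> P x) -> forall x, P x.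
Proof.
move=> IH x; apply: contrapT => nPx.
have [y [nPy miny]] := @wle_min (fun y => ~ P y) (ex_intro _ x nPx).
by apply: nPy; apply: IH => z zy; apply: contrapT => /miny; apply/negP.
Qed.

Lemma wlt_wf : well_founded (fun x y : o => wlt x y).
Proof. by move=> x; elim/wlt_ind: x => x IH; constructor. Qed.

End WellOrder.

Lemma pull_wo (T : Type) (o : Ord) (f : T -> o) : injective f ->
  well_order (fun x y => wle (f x) (f y)).
Proof.
move=> f_inj; apply: antisymmetric_well_order.
  by move=> x y /andP[xy yx]; apply/f_inj/wle_anti.
move=> A [x Ax].
have [_ [[y Ay <-] miny]] := @wle_min o (fun z => exists2 y, y \in A & f y = z)
  (ex_intro _ (f x) (ex_intro2 _ _ x Ax erefl)).
by exists y; split=> // z Az; apply: miny; exists z.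
Qed.

Definition pullO (T : Type) (o : Ord) (f : T -> o) (f_inj : injective f) : Ord :=
  MkOrd (pull_wo f_inj).

Lemma sval_inj (T : Type) (P : T -> Prop) : injective (@sval T P).
Proof. by move=> [x Px] [y Py] /= xy; apply: eq_exist. Qed.

Definition segO (o : Ord) (x : o) : Ord := pullO (@sval_inj o (fun y => wlt y x)).

Definition segI (o : Ord) (x y : o) (yx : wlt y x) : segO x :=
  exist (fun y => wlt y x) y yx.

Lemma segOP (o : Ord) (x : o) (y : segO x) : wlt (sval y) x.
Proof. exact: (proj2_sig y). Qed.

Definition mono_embedding (a b : Ord) (f : a -> b) := {mono f : x y / wle x y}.

Lemma mono_embedding_inj (a b : Ord) (f : a -> b) : mono_embedding f -> injective f.
Proof. by move=> fm x y fxy; apply: wle_anti; rewrite -fm fxy wle_refl. Qed.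

Lemma mono_embedding_lt (a b : Ord) (f : a -> b) x y :
  mono_embedding f -> wlt (f x) (f y) = wlt x y.
Proof. by move=> fm; rewrite !wltNge fm. Qed.

(** If [f x] were below a least such [x], then [f (f x)] would be below [f x],
    contradicting minimality. This rigidity is what makes ordinals comparable
    through arbitrary order embeddings. *)
Lemma mono_expansive (a : Ord) (f : a -> a) x : mono_embedding f -> wle x (f x).
Proof.
move=> fm; elim/wlt_ind: x => x IH; rewrite wleNgt; apply/negP => fx.
by have := IH _ fx; rewrite fm wleNgt fx.
Qed.

Lemma leO_refl a : a <=o a.
Proof. by exists id => // x y yx; exists y. Qed.

Lemma leO_trans b a c : a <=o b -> b <=o c -> a <=o c.
Proof.
move=> [f fm fi] [g gm gi]; exists (g \o f) => [x y|x y].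
  by rewrite /= gm fm.
by move=> /[dup]/gi[z <-]; rewrite /= gm => /fi[t <-]; exists t.
Qed.

Lemma leO_mono a b : a <=o b -> exists f : a -> b, mono_embedding f.
Proof. by case=> f fm _; exists f. Qed.

Lemma eqO_refl a : eqO a a. Proof. by split; apply: leO_refl. Qed.
Lemma eqO_sym a b : eqO a b -> eqO b a. Proof. by case. Qed.
Lemma eqO_trans b a c : eqO a b -> eqO b c -> eqO a c.
Proof. by move=> [ab ba] [bc cb]; split; apply: (@leO_trans b). Qed.

Lemma segO_le (a : Ord) (x : a) : segO x <=o a.
Proof.
exists (@sval _ _) => // -[z zx] y /= yz.
by exists (segI (wle_lt_trans yz zx)).
Qed.

Lemma mono_not_segO (a : Ord) (x : a) (f : a -> segO x) : ~ mono_embedding f.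
Proof.
move=> fm; have gm : mono_embedding (sval \o f : a -> a) by move=> y z; exact: fm.
by move: (mono_expansive x gm); apply/negP; apply: (segOP (f x)).
Qed.

Lemma segO_not_ge (a : Ord) (x : a) : ~ (a <=o segO x).
Proof. by move=> /leO_mono[f]; apply: mono_not_segO. Qed.

Lemma segO_lt (a : Ord) (x : a) : segO x <o a.
Proof. by split; [apply: segO_le | apply: segO_not_ge]. Qed.

Lemma segO_image (a b : Ord) (f : a -> b) (x : a) : mono_embedding f ->
    (forall x y, wle y (f x) -> exists z, f z = y) ->
  eqO (segO x) (segO (f x)).
Proof.
move=> fm fi; split.
  have P (y : segO x) : wlt (f (sval y)) (f x).
    by rewrite mono_embedding_lt //; apply: segOP.
  exists (fun y => segI (P y)) => [y z|y [z zx]].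
    exact: fm.
  move=> /fi[t tz]; have tx : wlt t x by rewrite -(mono_embedding_lt _ _ fm) tz.
  by exists (segI tx); apply/sval_inj.
have P (y : segO (f x)) : exists z : segO x, f (sval z) = sval y.
  have /wltW/fi[t ty] := segOP y.
  have tx : wlt t x by rewrite -(mono_embedding_lt _ _ fm) ty; apply: segOP.
  by exists (segI tx).
have [g gP] := choice P.
exists g => [y z|y z _]; first by rewrite /= -fm !gP.
have fzx : wlt (f (sval z)) (f x) by rewrite mono_embedding_lt //; apply: segOP.
exists (segI fzx); apply/sval_inj/(mono_embedding_inj fm).
exact: (gP (segI fzx)).
Qed.

Lemma segO_segO (a : Ord) (x : a) (y : segO x) : eqO (segO y) (segO (sval y)).
Proof.
apply: (@segO_image (segO x) a (@sval _ _)) => // -[z zx] t /= tz.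
by exists (segI (wle_lt_trans tz zx)).
Qed.

Lemma segO_leP (a : Ord) (x y : a) : (segO x <=o segO y) <-> wle x y.
Proof.
split=> [xy|xy].
  rewrite wleNgt; apply/negP => yx.
  have [_ le1] := segO_segO (segI yx).
  exact: (@segO_not_ge _ (segI yx) (leO_trans xy le1)).
have P (z : segO x) : wlt (sval z) y by apply: wlt_le_trans xy; apply: segOP.
exists (fun z => segI (P z)) => // -[z zx] [t ty] /= tz.
by exists (segI (wle_lt_trans tz zx)); apply/sval_inj.
Qed.

Lemma segO_inj (a : Ord) (x y : a) : eqO (segO x) (segO y) -> x = y.
Proof. by case=> /segO_leP xy /segO_leP yx; apply: wle_anti. Qed.

Lemma segO_downward (a b : Ord) (x : a) (y z : b) :
  eqO (segO x) (segO y) -> wle z y -> exists t : a, eqO (segO t) (segO z).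
Proof.
move=> exy /wle_eqVlt[->|zy]; first by exists x.
have [_ [g gm gi]] := exy.
exists (sval (g (segI zy))).
apply: eqO_trans (eqO_sym (segO_segO _)) _.
apply: eqO_trans (eqO_sym (segO_image _ gm gi)) _.
exact: segO_segO.
Qed.

(** The order isomorphism is forced: [x] goes to the point whose initial
    segment has the same type, which is unique by [segO_inj]. *)
Lemma leO_segO (a b : Ord) :
  (forall x : a, exists y : b, eqO (segO x) (segO y)) -> a <=o b.
Proof.
move=> /choice[f fP]; exists f => [x y|x y yfx].
  have [h1 h2] := fP x; have [h3 h4] := fP y.
  apply/idP/idP => /segO_leP H; apply/segO_leP.
    exact: leO_trans h1 (leO_trans H h4).
  exact: leO_trans h2 (leO_trans H h3).
have [z zP] := segO_downward (fP x) yfx; exists z.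
by apply: segO_inj; apply: eqO_trans zP; apply: eqO_sym.
Qed.

(** Otherwise take the least point on each side whose initial segment has no
    partner on the other side. Everything below them is matched, so their
    initial segments are isomorphic after all. *)
Lemma leO_total a b : a <=o b \/ b <=o a.
Proof.
apply: contrapT => /not_orP[nab nba].
have ex1 (c d : Ord) : ~ (c <=o d) ->
    exists x : c, ~ (exists y : d, eqO (segO x) (segO y)) /\
      forall x', wlt x' x -> exists y : d, eqO (segO x') (segO y).
  move=> ncd.
  have [|x [xP xmin]] := @wle_min c (fun x => ~ exists y : d, eqO (segO x) (segO y)).
    apply: contrapT => /forallNP nx; apply: ncd; apply: leO_segO => x.
    exact: contrapT (nx x).
  exists x; split=> // x' x'x; apply: contrapT => /xmin; apply/negP/x'x.
have [x [xP xlt]] := ex1 _ _ nab; have [y [yP ylt]] := ex1 _ _ nba.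
have half (c d : Ord) (u : c) (v : d) :
    ~ (exists t : c, eqO (segO v) (segO t)) ->
    (forall u', wlt u' u -> exists t : d, eqO (segO u') (segO t)) ->
    segO u <=o segO v.
  move=> vP ult; apply: leO_segO => -[z zu].
  have [t tP] := ult z zu.
  have tv : wlt t v.
    rewrite wltNge; apply/negP => vt; apply: vP.
    by have [s sP] := segO_downward tP vt; exists s; apply: eqO_sym.
  exists (segI tv); apply: eqO_trans (segO_segO _) _.
  by apply: eqO_trans tP _; apply/eqO_sym/(@segO_segO _ v).
by apply: (xP); exists y; split; apply: half.
Qed.

Lemma ltO_le a b : a <o b -> a <=o b. Proof. by case. Qed.

Lemma leO_or_gt a b : a <=o b \/ b <o a.
Proof.
by have [|nab] := pselect (a <=o b); [left|right; split=> //; case: (leO_total a b)].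
Qed.

Lemma leO_not_gt a b : a <=o b -> ~ (b <o a). Proof. by move=> ab []. Qed.

Lemma leO_lt_trans b a c : a <=o b -> b <o c -> a <o c.
Proof.
move=> ab [bc ncb]; split; first exact: leO_trans bc.
by move=> ca; apply/ncb/(leO_trans ca).
Qed.

Lemma ltO_le_trans b a c : a <o b -> b <=o c -> a <o c.
Proof.
move=> [ab nba] bc; split; first exact: leO_trans bc.
by move=> ca; apply/nba/(leO_trans bc).
Qed.

Lemma ltO_segO a b : b <o a -> exists x : a, eqO b (segO x).
Proof.
move=> [[f fm fi] nab].
have [|x [xP xmin]] := @wle_min a (fun x => ~ exists y, f y = x).
  apply: contrapT => /forallNP nx; apply: nab.
  have /choice[g gK] x := contrapT (nx x).
  exists g => [x y|x y _]; first by rewrite /= -fm !gK.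
  by exists (f y); apply/(mono_embedding_inj fm).
have fx y : wlt (f y) x.
  by rewrite wltNge; apply/negP => /fi.
exists x; split.
  exists (fun y => segI (fx y)) => // y [z zx] /fi[t tz].
  by exists t; apply/sval_inj.
have P (y : segO x) : exists z, f z = sval y.
  by apply: contrapT => /xmin; apply/negP/(segOP y).
have [g gP] := choice P.
exists g => [y z|y z _]; first by rewrite -fm !gP.
by exists (segI (fx z)); apply/(mono_embedding_inj fm); rewrite gP.
Qed.

(** The range need not be initial: if [b] were shorter than [a], composing with
    an isomorphism from [b] to an initial segment of [a] would contradict
    [mono_not_segO]. *)
Lemma mono_leO (a b : Ord) (f : a -> b) : mono_embedding f -> a <=o b.
Proof.
move=> fm; have [//|/ltO_segO[x [/leO_mono[g gm] _]]] := leO_or_gt a b.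
exfalso; apply: (@mono_not_segO a x (g \o f)) => y z.
exact: etrans (gm _ _) (fm _ _).
Qed.

(** Every ordinal below [a] is an initial segment of [a], so induction on
    ordinals reduces to induction inside the well-order [a]. *)
Lemma ltO_ind (P : Ord -> Prop) :
  (forall a, (forall b, b <o a -> P b) -> P a) -> forall a, P a.
Proof.
move=> IH a; apply: (IH) => b /ltO_segO[x].
elim/wlt_ind: x b => x IHx b [bx xb]; apply: IH => c cb.
have /ltO_segO[y [cy yc]] := ltO_le_trans cb bx.
apply: (IHx _ (segOP y)); have [h1 h2] := segO_segO y.
by split; [apply: leO_trans h1|apply: leO_trans yc].
Qed.

Lemma ex_is_least (P : Ord -> Prop) : (exists a, P a) -> exists a, is_least P a.
Proof.
move=> [a Pa]; apply: contrapT => nl; elim/ltO_ind: a Pa => a IH Pa.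
apply: nl; exists a; split=> // b Pb.
by have [//|ba] := leO_or_gt a b; case: (IH b).
Qed.

Lemma leastP (P : Ord -> Prop) : (exists a, P a) -> is_least P (least P).
Proof.
move=> /ex_is_least ex; rewrite /least; case: pselect => // ex'.
exact: projT2 (cid ex').
Qed.

Lemma least_cases (P : Ord -> Prop) : is_least P (least P) \/ least P = natO 0.
Proof.
rewrite /least; case: pselect => [ex'|]; last by right.
by left; apply: projT2 (cid ex').
Qed.

(** * Zero, successors and finite sums *)

Definition ord0_elim (T : Type) (i : 'I_0) : T := False_rect T (notF (ltn_ord i)).

Lemma natO0_le a : natO 0 <=o a.
Proof. by exists (fun x : natO 0 => ord0_elim a x) => -[]. Qed.

Lemma gtO_natO0 a : natO 0 <o a <-> ~ eqO a (natO 0).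
Proof.
split=> [a0 [le _]|na]; first exact: leO_not_gt le a0.
by have [le|//] := leO_or_gt a (natO 0); case: na; split=> //; apply: natO0_le.
Qed.

Lemma eqO_natO0_or_gt a : eqO a (natO 0) \/ natO 0 <o a.
Proof.
by have [|] := pselect (eqO a (natO 0)); [left | move/gtO_natO0; right].
Qed.

Lemma succO_gt a : a <o a +o natO 1.
Proof.
have le : a <=o a +o natO 1 by apply: (@mono_leO a (a +o natO 1) inl).
split=> // /leO_mono[f fm].
have gm : mono_embedding (inl \o f : a +o natO 1 -> a +o natO 1).
  by move=> x y; exact: fm.
exact: notF (mono_expansive (inr ord0 : a +o natO 1) gm).
Qed.

Lemma ltO_succ a b : b <o a +o natO 1 <-> b <=o a.
Proof.
split=> [/ltO_segO[u [bu _]]|ba]; last exact: leO_lt_trans (succO_gt a).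
apply: leO_trans bu _.
have P (v : segO u) : exists x : a, sval v = inl x.
  case: v => -[x|i] vu; first by exists x.
  by case: u vu => [x|j] //; rewrite /wlt /=  !ord1.
have [f fP] := choice P.
by apply: (@mono_leO _ _ f) => x y; rewrite /= !fP.
Qed.

Lemma succO_le a b : a <o b <-> a +o natO 1 <=o b.
Proof.
split=> [ab|]; last exact: ltO_le_trans (succO_gt a).
by have [//|/ltO_succ/leO_not_gt] := leO_or_gt (a +o natO 1) b.
Qed.

Lemma ord_cases a :
  [\/ eqO a (natO 0), exists b, eqO a (b +o natO 1) | limitO a].
Proof.
have [a0|a0] := eqO_natO0_or_gt a; first exact: Or31.
have [[b [ba nb]]|nb] := pselect (exists b, b <o a /\ ~ (b +o natO 1 <o a)).
  apply: Or32; exists b; split; last exact/succO_le.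
  by have [|/nb] := leO_or_gt a (b +o natO 1).
apply: Or33; split=> // b ba; apply: contrapT => nba; apply: nb.
by exists b.
Qed.

Lemma addO1_le a b : (natO 1 +o a <=o natO 1 +o b) <-> a <=o b.
Proof.
split=> [le|/leO_mono[f fm]].
  have [//|/ltO_segO[x [/leO_mono[f fm] _]]] := leO_or_gt a b.
  pose g (u : natO 1 +o b) : segO (inr x : natO 1 +o a) :=
    match u with
    | inl i => @segI (natO 1 +o a) (inr x) (inl i) isT
    | inr y => @segI (natO 1 +o a) (inr x) (inr (sval (f y))) (segOP (f y))
    end.
  exfalso; apply: (@segO_not_ge (natO 1 +o a) (inr x)); apply: leO_trans le _.
  by apply: (@mono_leO _ _ g) => -[i|y] [j|z] //=; exact: fm.
pose g (u : natO 1 +o a) : natO 1 +o b :=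
  match u with inl i => inl i | inr y => inr (f y) end.
by apply: (@mono_leO _ _ g) => -[i|y] [j|z] //=; exact: fm.
Qed.

Lemma addO1_lt a b : (natO 1 +o a <o natO 1 +o b) <-> a <o b.
Proof.
by split=> -[h1 h2]; split; try exact/addO1_le; move/addO1_le.
Qed.

Lemma addO1_ge1 a : natO 1 <=o natO 1 +o a.
Proof. by apply: (@mono_leO (natO 1) (natO 1 +o a) inl). Qed.

Lemma addO1_eq1 a : eqO (natO 1 +o a) (natO 1) <-> eqO a (natO 0).
Proof.
have -> : eqO (natO 1 +o a) (natO 1) <-> eqO (natO 1 +o a) (natO 1 +o natO 0).
  have h : eqO (natO 1) (natO 1 +o natO 0).
    split; first exact: addO1_ge1.
    by apply: (@mono_leO (natO 1 +o natO 0) (natO 1)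
      (fun u => match u with inl i => i | inr i => ord0_elim _ i end))
      => -[i|[]] // -[j|[]].
  by split=> [/eqO_trans|/eqO_trans]; apply=> //; apply: eqO_sym.
by split=> -[/addO1_le h1 /addO1_le h2]; split.
Qed.

Lemma ge1_addO1 x : natO 1 <=o x -> exists a, eqO x (natO 1 +o a).
Proof.
move=> [f _ _]; have [|m [_ mP]] := @wle_min x (fun _ => True).
  by exists (f ord0).
pose a := pullO (@sval_inj x (fun y => wlt m y)).
exists a; split.
  pose tail y (my : wlt m y) : a := exist (fun y : x => wlt m y) y my.
  pose g (y : x) : natO 1 +o a :=
    if pselect (wlt m y) is left my then inr (tail y my) else inl ord0.
  have gE y : (y = m /\ g y = inl ord0) \/
      exists my : wlt m y, g y = inr (tail y my).
    rewrite /g; case: pselect => my; first by right; exists my.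
    left; split=> //; apply: wle_anti (mP y I).
    by rewrite wleNgt; apply/negP.
  apply: (@mono_leO _ _ g) => y z.
  case: (gE y) => [[-> ->]|[my ->]]; case: (gE z) => [[-> ->]|[mz ->]] //=.
  - by rewrite !wle_refl.
  - by rewrite mP.
  - by apply/esym/negbTE.
pose g (u : natO 1 +o a) : x := match u with inl _ => m | inr y => sval y end.
apply: (@mono_leO _ _ g) => -[i|[y my]] [j|[z mz]] //=.
- by rewrite !ord1 wle_refl leqnn.
- exact: mP.
- exact/negbTE.
Qed.

Lemma addO0 a : eqO (a +o natO 0) a.
Proof.
split; last by apply: (@mono_leO a (a +o natO 0) inl).
by apply: (@mono_leO (a +o natO 0) a
      (fun u => match u with inl i => i | inr i => ord0_elim _ i end))
      => -[i|[]] // -[j|[]].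
Qed.

Lemma addO_succ a n : eqO (a +o natO n.+1) (a +o natO n +o natO 1).
Proof.
have bumpE (i : 'I_n) : bump n i = i by rewrite /bump leqNgt ltn_ord.
split.
  pose g (u : a +o natO n.+1) : a +o natO n +o natO 1 :=
    match u with
    | inl x => inl (inl x)
    | inr i => if unlift ord_max i is Some j then inl (inr j) else inr ord0
    end.
  have gE i : (exists2 j, i = lift ord_max j & g (inr i) = inl (inr j)) \/
      i = ord_max /\ g (inr i) = inr ord0.
    by rewrite /g; case: unliftP => [j ->|->]; [left; exists j | right].
  apply: (@mono_leO _ _ g) => -[x|i] [y|j] //.
  - by have [[k _ ->]|[_ ->]] := gE j.
  - by have [[k _ ->]|[_ ->]] := gE i.
  - have [[k -> ->]|[-> ->]] := gE i; have [[l -> ->]|[-> ->]] := gE j => /=.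
    + by rewrite !bumpE.
    + by rewrite bumpE ltnW.
    + by rewrite bumpE leqNgt ltn_ord.
    + by rewrite !leqnn.
pose g (u : a +o natO n +o natO 1) : a +o natO n.+1 :=
  match u with
  | inl (inl x) => inl x
  | inl (inr i) => inr (lift ord_max i)
  | inr _ => inr ord_max
  end.
apply: (@mono_leO _ _ g) => -[[x|i]|i] [[y|j]|j] //=.
- by rewrite !bumpE.
- by rewrite bumpE ltnW.
- by rewrite bumpE leqNgt ltn_ord.
- by rewrite !ord1 !leqnn.
Qed.

Lemma succO_mono a b : eqO a b -> eqO (a +o natO 1) (b +o natO 1).
Proof.
have le c d : c <=o d -> c +o natO 1 <=o d +o natO 1.
  by move=> cd; apply/succO_le/ltO_succ.
by case=> ab ba; split; apply: le.
Qed.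

(** * Existence of well-orders and upper bounds *)

Lemma ex_wo (T : Type) : exists o : Ord, carrier o = T.
Proof.
have [R Rwo] := well_ordering_principle {classic T}.
by exists (@MkOrd {classic T} R Rwo).
Qed.

(** Any well-order on the power set of the disjoint union of the family is a
    bound: were it embeddable in a member, Cantor's diagonal argument would
    apply to the union. *)
Lemma ex_upper_boundO (I : Type) (b : I -> Ord) : exists a, forall i, b i <o a.
Proof.
have [a aE] := ex_wo (set {i : I & b i}).
exists a => i; have [|//] := leO_or_gt a (b i).
move=> /leO_mono[f /mono_embedding_inj f_inj].
move: f f_inj; rewrite aE => f f_inj; exfalso.
(* Partial inverse of the inclusion of [b i] in the disjoint union. *)
pose r (u : {i : I & b i}) : option (b i) :=
  if pselect (projT1 u = i) is left e then Some (ecast j (b j) e (projT2 u)) else None.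
have rE x : r (existT _ i x) = Some x.
  by rewrite /r; case: pselect => //= e; rewrite (Prop_irrelevance e erefl).
pose D : set {i : I & b i} := [set u | exists2 A, r u = Some (f A) & ~ A u].
have [DD|nDD] := pselect (D (existT _ i (f D))); last by apply: (nDD); exists D.
by case: (DD) => A; rewrite rE => -[/f_inj <-]; apply.
Qed.

(** * Cardinalities as injections *)

Definition emb (A B : Type) : Prop := exists f : A -> B, injective f.

Lemma emb_refl A : emb A A. Proof. by exists id. Qed.

Lemma emb_trans B A C : emb A B -> emb B C -> emb A C.
Proof. by move=> [f fI] [g gI]; exists (g \o f); apply: inj_comp. Qed.

Lemma emb_sig T (P : T -> Prop) : emb {x | P x} T.
Proof. by exists sval; apply: sval_inj. Qed.

Lemma emb_leO (a b : Ord) : a <=o b -> emb a b.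
Proof. by move=> /leO_mono[f /mono_embedding_inj]; exists f. Qed.

Lemma emb_total A B : emb A B \/ emb B A.
Proof.
have [a <-] := ex_wo A; have [b <-] := ex_wo B.
by have [] := leO_total a b => /emb_leO; [left|right].
Qed.

Lemma emb_prod A A' B B' : emb A A' -> emb B B' -> emb (A * B) (A' * B').
Proof.
move=> [f fI] [g gI]; exists (fun p => (f p.1, g p.2)).
by move=> [x y] [x' y'] /= [/fI -> /gI ->].
Qed.

Lemma emb_option A B : emb A B -> emb (option A) (option B).
Proof.
by move=> [f fI]; exists (omap f) => -[x|] [y|] //= [/fI->].
Qed.

Lemma emb_set A B : emb A B -> emb (set A) (set B).
Proof.
move=> [f fI]; exists (fun U => f @` U).
have sub U V : f @` U = f @` V -> U `<=` V.
  move=> UV x Ux; have : (f @` V) (f x) by rewrite -UV; exists x.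
  by case=> y Vy /fI <-.
by move=> U V UV; apply/seteqP; split; apply: sub.
Qed.

Lemma emb_fun A B : emb (A -> B) (set (A * B)).
Proof.
exists (fun h => [set p | h p.1 = p.2]) => h k hk; apply/funext => x.
by have : [set p | k p.1 = p.2] (x, h x) by rewrite -hk.
Qed.

Lemma emb_arrow A B C : emb B C -> emb (A -> B) (A -> C).
Proof.
move=> [f fI]; exists (fun h => f \o h) => h k hk; apply/funext => x.
by apply: fI; apply: (congr1 (fun h => h x) hk).
Qed.

Lemma emb_uncurry A B : emb (A -> set B) (set (A * B)).
Proof.
exists (fun h => [set p | h p.1 p.2]) => h k hk.
apply/funext => x; apply/seteqP; split=> y hy.
  by have : [set p | k p.1 p.2] (x, y) by rewrite -hk.
by have : [set p | h p.1 p.2] (x, y) by rewrite hk.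
Qed.

Lemma card_le_emb T U (A : set T) (B : set U) : (A #<= B) <-> emb A B.
Proof.
split=> [/card_leP/injfunPex[f _ fI]|[f fI]].
  by exists f => x y fxy; apply: fI; rewrite ?in_setE.
by apply/card_leP/injfunPex; exists f => // x y _ _; apply: fI.
Qed.

Lemma emb_setT A : emb A [set: A].
Proof. by exists to_setT => x y []. Qed.

Lemma card_leE A B : ([set: A] #<= [set: B]) <-> emb A B.
Proof.
rewrite card_le_emb; split=> [AB|AB].
  apply: emb_trans (emb_setT A) (emb_trans AB _); exact: emb_sig.
by apply: emb_trans (emb_trans AB (emb_setT B)); apply: emb_sig.
Qed.

Lemma emb_finite A : ~ emb nat A <-> finite_set [set: A].
Proof.
by rewrite finite_setPn card_leE.
Qed.

(** Hilbert's hotel: shifting a copy of the natural numbers makes room for one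
    more point. *)
Lemma emb_option_infinite A : emb nat A -> emb (option A) A.
Proof.
move=> [f fI].
pose next x := if pselect (exists n, f n = x) is left ex then f (projT1 (cid ex)).+1
               else x.
have nextf n : next (f n) = f n.+1.
  rewrite /next; case: pselect => [ex|]; last by case; exists n.
  by congr f; congr S; apply: fI; apply: projT2 (cid ex).
have nextN x : ~ (exists n, f n = x) -> next x = x.
  by move=> nx; rewrite /next; case: pselect.
exists (fun u => if u is Some x then next x else f 0).
have cases x : (exists2 n, f n = x & next x = f n.+1) \/
    ~ (exists n, f n = x) /\ next x = x.
  have [[n <-]|nx] := pselect (exists n, f n = x); last by right; rewrite nextN.
  by left; exists n.
move=> [x|] [y|] //.
- have [[n <- ->]|[nx ->]] := cases x; have [[m <- ->]|[ny ->]] := cases y.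
  + by move=> /fI[->].
  + by move=> e; case: ny; exists n.+1.
  + by move=> e; case: nx; exists m.+1.
  + by move=> ->.
- have [[n <- ->]|[nx ->]] := cases x; first by move=> /fI.
  by move=> e; case: nx; exists 0.
- have [[n <- ->]|[nx ->]] := cases y; first by move=> /fI.
  by move=> e; case: nx; exists 0.
Qed.

(** Comparing ranks first and breaking ties by an arbitrary well-order: the
    least element has least rank and then comes first among its rank. *)
Lemma lex_rank_wo (T : Type) (a : Ord) (r : T -> a) (o : Ord) (f : T -> o) :
    injective f ->
  well_order (fun x y => wlt (r x) (r y) || ((wle (r x) (r y)) && wle (f x) (f y))).
Proof.
move=> fI; apply: antisymmetric_well_order.
  move=> x y /andP[/orP[xy|/andP[xy fxy]] /orP[yx|/andP[yx fyx]]].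
  - by move: (wltW xy); rewrite wleNgt yx.
  - by move: xy; rewrite wltNge yx.
  - by move: yx; rewrite wltNge xy.
  - by apply/fI/wle_anti.
move=> A [x Ax].
have [|m [[y [Ay ym]] mmin]] := @wle_min a (fun m => exists y, y \in A /\ r y = m).
  by exists (r x), x.
have [|n [[z [Az zm zn]] nmin]] :=
    @wle_min o (fun n => exists z, [/\ z \in A, r z = m & f z = n]).
  by exists (f y), y.
exists z; split=> // t At; rewrite zm zn.
have /wle_eqVlt[mt|->//] : wle m (r t) by apply: mmin; exists t.
by rewrite -mt wle_refl /= nmin ?orbT //; exists t.
Qed.

(** Hessenberg's theorem. Well-order the pairs by their maximum first. The
    pairs preceding a given one lie in the square of a closed initial segment,
    which by induction is smaller than [a] unless [a] itself embeds in a proper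
    initial segment; so this well-order of the square is no longer than [a]. *)
Lemma emb_square (a : Ord) : emb nat a -> emb (a * a) a.
Proof.
elim/ltO_ind: a => a IH a_inf.
have [[x ax]|na] := pselect (exists x : a, emb a (segO x)).
  apply: emb_trans (emb_prod ax ax) _.
  apply: emb_trans (IH _ (segO_lt x) (emb_trans a_inf ax)) _.
  exact: emb_leO (segO_le x).
pose r (p : a * a) := if wle p.1 p.2 then p.2 else p.1.
have r1 p : wle p.1 (r p) by rewrite /r; case: ifP => //; rewrite wle_refl.
have r2 p : wle p.2 (r p).
  rewrite /r; case: ifP => [_|/negbT/wltW //]; exact: wle_refl.
have [o oE] := ex_wo (a * a)%type.
have [f fI] : emb (a * a) o by rewrite oE; apply: emb_refl.
pose G := MkOrd (lex_rank_wo r fI).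
have [Ga|aG] := leO_or_gt G a; first exact: (emb_leO Ga).
exfalso; have [p /proj1/emb_leO ap] := ltO_segO aG.
(* The closed segment up to [m], with [None] standing for [m] itself. *)
pose m := r p; pose D := option (segO m).
have embD : emb a (D * D).
  apply: emb_trans ap _.
  have low (y : a) : exists d : D, wle y m ->
      if d is Some z then y = sval z else y = m.
    have [/wle_eqVlt[->|ym]|nym] := pselect (wle y m); [|exists (Some (segI ym))|]
      => //; by exists None.
  have [h hP] := choice low.
  exists (fun q => (h (sval q).1, h (sval q).2)).
  have rq (q : segO p) : wle (r (sval q)) m.
    have := segOP q; rewrite /wlt /= negb_or => /andP[+ _].
    by rewrite /wlt negbK.
  move=> q q' /= [h1 h2]; apply: sval_inj.
  have q1 (t : segO p) := hP _ (wle_trans (r1 (sval t)) (rq t)).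
  have q2 (t : segO p) := hP _ (wle_trans (r2 (sval t)) (rq t)).
  move: (q1 q) (q1 q') (q2 q) (q2 q'); rewrite h1 h2.
  case: (sval q) (sval q') => [x y] [x' y'] /=.
  by case: (h x') => [?|] -> ->; case: (h y') => [?|] -> ->.
have [m_inf|m_fin] := pselect (emb nat (segO m)).
  apply: na; exists m; apply: emb_trans embD _.
  have Dm := emb_option_infinite m_inf.
  exact: emb_trans (emb_prod Dm Dm) (IH _ (segO_lt m) m_inf).
have D_fin : finite_set [set: D].
  have -> : [set: D] = [set None] `|` some @` [set: segO m].
    by apply/seteqP; split=> // -[z|] _; [right; exists z | left].
  by rewrite finite_setU; split; [apply: finite_set1 | apply/finite_image/emb_finite].
have : ~ emb nat (D * D).
  apply/emb_finite; have -> : [set: (D * D)%type] = [set: D] `*` [set: D].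
    by apply/seteqP; split.
  exact: finite_setX.
by apply; apply: emb_trans embD.
Qed.

(** * Smallness with respect to a cardinal *)

(** Since cardinalities are comparable, this says that [I] has cardinality
    less than that of [k]. *)
Definition small (k : Ord) (I : Type) : Prop := ~ emb k I.

Section InfiniteCardinal.
Variable k : Ord.
Hypotheses (k_card : cardinal k) (k_inf : omegaO <o k).
Implicit Types I J : Type.

Lemma small_emb I J : emb I J -> small k J -> small k I.
Proof. by move=> IJ kJ kI; apply/kJ/(emb_trans kI). Qed.

Lemma small_lt (d : Ord) : d <o k -> small k d.
Proof. by move=> /k_card; rewrite card_leE. Qed.

Lemma small_ltO (d : Ord) : small k d -> d <o k.
Proof. by have [/emb_leO|] := leO_or_gt k d. Qed.

Lemma smallP I : small k I <-> exists2 d : Ord, d <o k & carrier d = I.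
Proof.
split=> [kI|[d /small_lt kd <- //]].
by have [o oI] := ex_wo I; exists o => //; apply: small_ltO; rewrite oI.
Qed.

Lemma small_segO (x : k) : small k (segO x).
Proof. exact/small_lt/segO_lt. Qed.

Lemma small_emb_segO I : small k I -> exists x : k, emb I (segO x).
Proof.
move=> /smallP[d dk <-]; have [x /proj1/emb_leO dx] := ltO_segO dk.
by exists x.
Qed.

Lemma small_nat : small k nat.
Proof. exact: (small_lt k_inf). Qed.

Lemma emb_nat : emb nat k.
Proof. exact: (emb_leO (ltO_le k_inf)). Qed.

Lemma emb_k_square : emb (k * k) k.
Proof. exact/emb_square/emb_nat. Qed.

Lemma small_max I J : small k I -> small k J ->
  exists M, [/\ small k M, emb I M, emb J M & emb nat M].
Proof.
have max2 A B : small k A -> small k B -> exists M, [/\ small k M, emb A M & emb B M].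
  move=> kA kB; have [AB|BA] := emb_total A B; [exists B|exists A]; split=> //;
    exact: emb_refl.
move=> kI kJ; have [M [kM IM JM]] := max2 _ _ kI kJ.
have [N [kN MN nN]] := max2 _ _ kM small_nat.
by exists N; split=> //; [apply: emb_trans IM _ | apply: emb_trans JM _].
Qed.

Lemma emb_square_infinite I : emb nat I -> emb (I * I) I.
Proof. by have [o <-] := ex_wo I; apply: emb_square. Qed.

Lemma small_prod I J : small k I -> small k J -> small k (I * J).
Proof.
move=> kI kJ; have [M [kM IM JM nM]] := small_max kI kJ.
apply: small_emb kM; apply: emb_trans (emb_prod IM JM) _.
exact: emb_square_infinite.
Qed.

Lemma small_option I : small k I -> small k (option I).
Proof.
move=> kI; have [M [kM IM _ nM]] := small_max kI kI.
apply: small_emb kM; apply: emb_trans (emb_option IM) _.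
exact: emb_option_infinite.
Qed.

Lemma small_sig I (P : I -> Prop) : small k I -> small k {i | P i}.
Proof. by apply: small_emb; apply: emb_sig. Qed.

Lemma small_bool : small k bool.
Proof. by apply: small_emb small_nat; exists nat_of_bool => -[] []. Qed.

Lemma small_unit : small k unit.
Proof. by apply: small_emb small_nat; exists (fun=> 0) => -[] []. Qed.

Definition below (x : k) : Type := {y : k | wle y x}.

Lemma small_below (x : k) : small k (below x).
Proof.
apply: (small_emb _ (small_option (@small_segO x))).
have low (y : below x) : exists d : option (segO x),
    if d is Some z then sval y = sval z else sval y = x.
  case: y => y /= /wle_eqVlt[->|yx]; first by exists None.
  by exists (Some (segI yx)).
have [h hP] := choice low; exists h => y z yz; apply: sval_inj.
by have := hP y; have := hP z; rewrite yz; case: (h z) => [?|] -> ->.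
Qed.

Lemma small_emb_below I : small k I -> exists x : k, emb I (below x).
Proof.
move=> /small_emb_segO[x Ix]; exists x; apply: emb_trans Ix _.
by exists (fun y => exist _ (sval y) (wltW (segOP y)) : below x) => y z [/sval_inj].
Qed.

End InfiniteCardinal.

Lemma ex_cardinal (I : Type) : exists2 c : Ord, cardinal c &
  emb I c /\ forall o : Ord, emb I o -> c <=o o.
Proof.
have [|c [Ic cmin]] := @ex_is_least (fun o => emb I o).
  by have [o oI] := ex_wo I; exists o; rewrite oI; apply: emb_refl.
exists c => // b bc; rewrite card_leE => cb.
by apply: leO_not_gt bc; apply/cmin/(emb_trans Ic).
Qed.

Lemma emb_succ_card (k d : Ord) : cardinal k -> d <o succ_card k -> emb d k.
Proof.
move=> k_card; rewrite /succ_card.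
(* [least] could only default to 0, below which there is no ordinal. *)
set P := (fun n => _); have [[_ minP] dlt|->] := least_cases P; last first.
  by move=> [_ []]; apply: natO0_le.
apply: contrapT => ndk.
have [c c_card [dc cmin]] := ex_cardinal d.
apply: leO_not_gt (cmin d (emb_refl d)) _; apply: (ltO_le_trans dlt).
apply: minP; split=> //; have [ck|//] := leO_or_gt c k.
by case: ndk; apply: emb_trans (emb_leO ck).
Qed.

(** * Singular cardinals equal to their weak power are strong limits *)

Section SingularStrongLimit.
Variable k : Ord.
Hypotheses (k_sing : singular_cardinal k) (k_pow : eqO (pow2_lt k) k).

Let k_card : cardinal k. Proof. by case: k_sing. Qed.
Let k_inf : omegaO <o k. Proof. by case: k_sing. Qed.

Lemma small_cof : small k (cof k).
Proof. by apply: small_lt => //; case: k_sing. Qed.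

Lemma cof_cofinal : exists f : cof k -> k, forall x, exists i, wle x (f i).
Proof.
have [] // := @leastP (fun d => exists f : d -> k, forall x, exists i, wle x (f i)).
by exists k, id => x; exists x; apply: wle_refl.
Qed.

Lemma emb_set_small (I : Type) : small k I -> emb (set I) k.
Proof.
move=> kI; have [c c_card [Ic cmin]] := ex_cardinal I.
have ck : c <o k.
  have /(smallP k_card)[d dk dI] := kI.
  by apply: leO_lt_trans dk; apply: cmin; rewrite dI; apply: emb_refl.
move: k_pow; rewrite /pow2_lt.
(* The default value 0 of [least] is excluded, being different from [k]. *)
set P := (fun n => _); have [[[_ powP] _] [nk _]|->] := least_cases P.
  apply: emb_trans (emb_set Ic) _; apply: emb_trans (emb_leO nk).
  exact/card_leE/powP.
move=> [_ k0]; exfalso; apply: leO_not_gt k0 _.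
exact: leO_lt_trans (natO0_le _) k_inf.
Qed.

(** König's diagonal argument: for each index [j], the functions coded below
    [f j] are too few to take all values at [j], and a function that takes a
    missed value at every [j] has no code. *)
Lemma konig : ~ emb (cof k -> k) k.
Proof.
move=> [g gI]; have [f fP] := cof_cofinal.
have /choice[h hP] (j : cof k) : exists y, forall u, wle (g u) (f j) -> u j <> y.
  apply: contrapT => /forallNP ny.
  have /choice[u uP] (y : k) : exists u, wle (g u) (f j) /\ u j = y.
    have /existsNP[u /not_implyP[uf /contrapT uy]] := ny y.
    by exists u.
  apply: (small_below k_card k_inf (x := f j)).
  exists (fun y => exist _ (g (u y)) (proj1 (uP y)) : below (f j)).
  by move=> y z [/gI yz]; rewrite -(proj2 (uP y)) -(proj2 (uP z)) yz.
by have [j jP] := fP (g h); apply: (hP j h jP).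
Qed.

(** If [k] embedded in the power set of a small type, then functions from the
    cofinality of [k] to [k] could be coded by subsets of a small type, hence
    by elements of [k]. *)
Lemma small_set (I : Type) : small k I -> small k (set I).
Proof.
move=> kI kset; apply: konig.
apply: emb_trans (emb_arrow _ kset) _; apply: emb_trans (emb_uncurry _ _) _.
by apply: emb_set_small; apply: small_prod => //; apply: small_cof.
Qed.

Lemma small_fun (I J : Type) : small k I -> small k J -> small k (I -> J).
Proof.
by move=> kI kJ; apply: small_emb (emb_fun _ _) _; apply/small_set/small_prod.
Qed.

End SingularStrongLimit.

(** * Small unions of sets in a class *)

Lemma emb_reindex (T I J : Type) (F : I -> T) (t0 : T) : emb I J ->
  exists G : J -> T, (forall i, exists j, G j = F i) /\
    forall j, G j = t0 \/ exists i, G j = F i.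
Proof.
move=> [f fI].
have /choice[G GP] (j : J) : exists t,
    (exists2 i, f i = j & t = F i) \/ ~ (exists i, f i = j) /\ t = t0.
  have [[i ij]|nj] := pselect (exists i, f i = j); last by exists t0; right.
  by exists (F i); left; exists i.
exists G; split=> [i|j]; last by case: (GP j) => [[i _]|[_]]; [right; exists i|left].
by exists (f i); case: (GP (f i)) => [[j /fI -> //]|[[]]]; exists i.
Qed.

Lemma bigcup_pad (T I J : Type) (P : set (set T)) (F : I -> set T) :
    P set0 -> (forall i, P (F i)) -> emb I J ->
  exists2 G : J -> set T, (forall j, P (G j)) & \bigcup_i F i = \bigcup_j G j.
Proof.
move=> P0 PF /(emb_reindex F set0)[G [FG GF]].
exists G => [j|]; first by case: (GF j) => [->|[i ->]].
apply/seteqP; split=> x [i _ xi].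
  by have [j jG] := FG i; exists j; rewrite // jG.
by have [i0|[j ij]] := GF i; [rewrite i0 in xi|exists j; rewrite // -ij].
Qed.

Section SmallUnions.
Variable k : Ord.
Hypotheses (k_sing : singular_cardinal k) (k_pow : eqO (pow2_lt k) k).

Let k_card : cardinal k. Proof. by case: k_sing. Qed.
Let k_inf : omegaO <o k. Proof. by case: k_sing. Qed.

Variables (X : Type) (P : set (set X)).

(** Each member of the family is a small union of sets in [P], with one small
    index type [E] for all of them; this common bound is what allows families
    to be complemented and intersected. *)
Definition uniform (I : Type) (D : I -> set X) : Prop :=
  exists2 E : Type, small k E & exists2 F : I -> E -> set X,
    (forall i e, P (F i e)) & forall i, D i = \bigcup_e F i e.

Definition small_union : set (set X) := [set A | uniform (fun _ : unit => A)].

Definition card_union : set (set X) :=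
  [set A | exists2 F : k -> set X, (forall x, P (F x)) & A = \bigcup_x F x].

Lemma small_unionP A : small_union A <->
  exists2 E : Type, small k E & exists2 F : E -> set X,
    (forall e, P (F e)) & A = \bigcup_e F e.
Proof.
split=> [[E kE [F PF AF]]|[E kE [F PF AF]]].
  by exists E => //; exists (F tt) => // e.
by exists E => //; exists (fun _ => F).
Qed.

Lemma uniform_comp (I J : Type) (D : I -> set X) (h : J -> I) :
  uniform D -> uniform (D \o h).
Proof.
move=> [E kE [F PF DF]]; exists E => //.
by exists (fun j => F (h j)) => [j e|j]; [apply: PF | apply: DF].
Qed.

Lemma uniform_eq (I : Type) (D D' : I -> set X) :
  (forall i, D i = D' i) -> uniform D -> uniform D'.
Proof. by move=> /funext ->. Qed.

Lemma uniform_small_union (I : Type) (D : I -> set X) i :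
  uniform D -> small_union (D i).
Proof. exact: (uniform_comp (fun _ : unit => i)). Qed.

Lemma uniform_bigcup (I T : Type) (D : I -> T -> set X) : small k T ->
    uniform (fun p : I * T => D p.1 p.2) ->
  uniform (fun i => \bigcup_t D i t).
Proof.
move=> kT [E kE [F PF DF]]; exists (T * E)%type; first exact: small_prod.
exists (fun i p => F (i, p.1) p.2) => [i e|i]; first exact: PF.
apply/seteqP; split=> x.
  by move=> [t _]; rewrite (DF (i, t)) => -[e _ xe]; exists (t, e).
by move=> [[t e] _ xe]; exists t => //; rewrite (DF (i, t)); exists e.
Qed.

(* [P] abstracts the dual class at a rank of the even kind. *)
Hypothesis P_set0 : P set0.
Hypothesis P_bigcap : forall (I : Type) (F : I -> set X), small k I ->
  (forall i, P (F i)) -> P (\bigcap_i F i).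
Variable N : Type.
Hypothesis N_small : small k N.
Hypothesis P_compl : forall A, P A -> exists2 G : N -> set X,
  (forall n, P (G n)) & ~` A = \bigcup_n G n.

(** Complementation turns a small union of small intersections into another
    one by distributivity: the new union ranges over a function space, which
    is small because the cardinal is strong limit. *)
Lemma uniform_setC (I : Type) (D : I -> set X) :
  uniform D -> uniform (fun i => ~` D i).
Proof.
move=> [E kE [F PF DF]]; exists (E -> N); first exact: small_fun.
have /choice[G GP] (p : I * E) : exists G : N -> set X,
    (forall n, P (G n)) /\ ~` F p.1 p.2 = \bigcup_n G n.
  by have [G] := P_compl (PF p.1 p.2); exists G.
exists (fun i h => \bigcap_e G (i, e) (h e)) => [i h|i].
  by apply: P_bigcap => // e; apply: (proj1 (GP (i, e))).
rewrite DF setC_bigcup; apply/seteqP; split=> x.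
  move=> xF; have /choice[h hP] (e : E) : exists n, G (i, e) n x.
    have := xF e Logic.I; rewrite (proj2 (GP (i, e))) => -[n _]; by exists n.
  by exists h => // e _.
by move=> [h _ xh] e _; rewrite (proj2 (GP (i, e))); exists (h e) => //; apply: xh.
Qed.

Lemma uniform_setI (I : Type) (D D' : I -> set X) :
  uniform D -> uniform D' -> uniform (fun i => D i `&` D' i).
Proof.
move=> [E kE [F PF DF]] [E' kE' [F' PF' DF']].
exists (E * E')%type; first exact: small_prod.
exists (fun i p => F i p.1 `&` F' i p.2) => [i e|i].
  have -> : F i e.1 `&` F' i e.2 = \bigcap_(b : bool) (if b then F i e.1 else F' i e.2).
    apply/seteqP; split=> [x [x1 x2] [] //|x xb].
    by split; [apply: (xb true) | apply: (xb false)].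
  by apply: P_bigcap => [|[]] //; apply: small_bool.
rewrite DF DF'; apply/seteqP; split=> x.
  by move=> [[e _ xe] [e' _ xe']]; exists (e, e').
by move=> [[e e'] _ [xe xe']]; split; [exists e | exists e'].
Qed.

Lemma uniform_bigcap (I T : Type) (D : I -> T -> set X) : small k T ->
    uniform (fun p : I * T => D p.1 p.2) ->
  uniform (fun i => \bigcap_t D i t).
Proof.
move=> kT /uniform_setC uD.
have := uniform_setC (uniform_bigcup (D := fun i t => ~` D i t) kT uD).
by apply: uniform_eq => i; rewrite -setC_bigcap setCK.
Qed.

Lemma uniform_sum (I J : Type) (D : I -> set X) (D' : J -> set X) :
    uniform D -> uniform D' ->
  uniform (fun u : I + J => match u with inl i => D i | inr j => D' j end).
Proof.
move=> [E kE [F PF DF]] [E' kE' [F' PF' DF']].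
have [M [kM EM E'M _]] := small_max k_card k_inf kE kE'.
exists M => //.
have /choice[H HP] (u : I + J) : exists H : M -> set X, (forall e, P (H e)) /\
    match u with inl i => D i | inr j => D' j end = \bigcup_e H e.
  case: u => i; rewrite ?DF ?DF'.
    by have [H PH HE] := bigcup_pad P_set0 (PF i) EM; exists H.
  by have [H PH HE] := bigcup_pad P_set0 (PF' i) E'M; exists H.
by exists H => u; have [] := HP u.
Qed.

Lemma uniform_cases (I : Type) (b : I -> Prop) (D1 D2 D : I -> set X) :
    (forall i, b i /\ D i = D1 i \/ ~ b i /\ D i = D2 i) ->
  uniform D1 -> uniform D2 -> uniform D.
Proof.
move=> bD u1 u2.
pose h i : I + I := if pselect (b i) then inl i else inr i.
apply: uniform_eq (uniform_comp h (uniform_sum u1 u2)) => i /=.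
by rewrite /h; case: pselect => bi; case: (bD i) => -[].
Qed.

Lemma uniform_class (I : Type) (D : I -> set X) : (forall i, P (D i)) -> uniform D.
Proof.
move=> PD; exists unit; first exact: small_unit.
exists (fun i _ => D i) => // i.
by apply/seteqP; split=> [x xi|x [_ _]]; [exists tt|].
Qed.

Lemma small_union_class A : P A -> small_union A.
Proof. by move=> PA; apply: uniform_class. Qed.

Lemma small_union_setC A : small_union A -> small_union (~` A).
Proof. exact: (uniform_setC (D := fun _ : unit => A)). Qed.

Lemma small_union_setI A B : small_union A -> small_union B -> small_union (A `&` B).
Proof.
exact: (uniform_setI (D := fun _ : unit => A) (D' := fun _ : unit => B)).
Qed.

Lemma small_union_bigcup (T : Type) (D : T -> set X) : small k T -> uniform D ->
  small_union (\bigcup_t D t).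
Proof.
move=> kT uD; apply: (uniform_bigcup (D := fun _ : unit => D)) => //.
exact: uniform_comp snd uD.
Qed.

Lemma small_card_union A : small_union A -> card_union A.
Proof.
move=> /small_unionP[E /(small_emb_segO k_card)[y Ey] [F PF ->]].
have Ek : emb E k by apply: emb_trans Ey _; apply: emb_leO (segO_le y).
by have [G PG ->] := bigcup_pad P_set0 PF Ek; exists G.
Qed.

Lemma card_union_bigcup (T : Type) (A : T -> set X) : emb T k ->
  (forall t, card_union (A t)) -> card_union (\bigcup_t A t).
Proof.
move=> Tk cA.
have /choice[F FP] (t : T) : exists F : k -> set X,
    (forall x, P (F x)) /\ A t = \bigcup_x F x by have [F] := cA t; exists F.
have -> : \bigcup_t A t = \bigcup_(p : T * k) F p.1 p.2.
  apply/seteqP; split=> x.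
    by move=> [t _]; rewrite (proj2 (FP t)) => -[y _ xy]; exists (t, y).
  by move=> [[t y] _ xy]; exists t => //; rewrite (proj2 (FP t)); exists y.
have Tkk : emb (T * k) k.
  by apply: emb_trans (emb_prod Tk (emb_refl k)) _; apply: emb_k_square.
have PF (p : T * k) : P (F p.1 p.2) by apply: (proj1 (FP p.1)).
by have [G PG ->] := bigcup_pad P_set0 PF Tkk; exists G.
Qed.

Lemma card_union_setI A B : card_union A -> small_union B -> card_union (A `&` B).
Proof.
move=> [F PF ->] uB; rewrite setI_bigcupl; apply: card_union_bigcup.
  exact: emb_refl.
move=> x; apply/small_card_union/small_union_setI => //.
exact: small_union_class.
Qed.

Lemma emb_small_k (T : Type) : small k T -> emb T k.
Proof. by have [] := emb_total T k. Qed.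

Lemma card_union_small_bigcup (T : Type) (A : T -> set X) : small k T ->
  (forall t, card_union (A t)) -> card_union (\bigcup_t A t).
Proof. by move=> /emb_small_k; apply: card_union_bigcup. Qed.

(** A union of [k] sets splits into cofinality many small unions. *)
Lemma card_union_cof A : card_union A -> exists2 B : cof k -> set X,
  (forall j, small_union (B j)) & A = \bigcup_j B j.
Proof.
move=> [F PF ->]; have [f fP] := cof_cofinal k.
exists (fun j => \bigcup_(y : below (f j)) F (sval y)) => [j|].
  apply/small_unionP; exists (below (f j)); first exact: small_below.
  by exists (fun y => F (sval y)) => // y; apply: PF.
apply/seteqP; split=> x.
  by move=> [y _ xy]; have [j yj] := fP y; exists j => //; exists (exist _ y yj).
by move=> [j _ [y _ xy]]; exists (sval y).
Qed.

(** * Collapse of the hierarchy at an ambiguous class *)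

Hypothesis ambiguous :
  forall A, card_union A -> card_union (~` A) -> small_union A.

(** The sets on which the conclusion of the collapse already holds. *)
Definition null (D : set X) : Prop :=
  forall B, card_union B -> B `<=` D -> small_union B.

Lemma null_sub (D E : set X) : D `<=` E -> null E -> null D.
Proof. by move=> DE nE B cB BD; apply: nE => // x /BD/DE. Qed.

Lemma uniform_set0 (I : Type) : uniform (fun _ : I => set0).
Proof. exact: uniform_class. Qed.

Lemma uniform_setT (I : Type) : uniform (fun _ : I => setT).
Proof.
by apply: uniform_eq (uniform_setC (@uniform_set0 I)) => i; rewrite setC0.
Qed.

(** The union of the [B s] is ambiguous, because its complement consists of the
    parts [D s] minus [B s] and the complement of all [D s]. So it is a small
    union, and its traces on the [D s] inherit a common bound. *)
Lemma uniform_disjoint (S : Type) (D B : S -> set X) : small k S -> uniform D ->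
    (forall s t x, D s x -> D t x -> s = t) ->
    (forall s, small_union (B s)) -> (forall s, B s `<=` D s) ->
  uniform B.
Proof.
move=> kS uD disjD sB BD; pose A := \bigcup_s B s.
have sA : small_union A.
  apply: ambiguous.
    by apply: card_union_small_bigcup => // s; apply: small_card_union.
  pose C (o : option S) : set X :=
    if o is Some s then D s `&` ~` B s else ~` (\bigcup_s D s).
  have -> : ~` A = \bigcup_o C o.
    apply/seteqP; split=> x.
      move=> nA; have [[s _ xs]|nD] := pselect ((\bigcup_s D s) x).
        by exists (Some s) => //; split=> // xB; apply: nA; exists s.
      by exists None.
    move=> [[s|] _ /= xC] [t _ xt].
      case: xC => xD; have <- : t = s; last by [].
      by apply: (disjD _ _ x) => //; apply: BD.
    by apply: xC; exists t => //; apply: BD.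
  apply: card_union_small_bigcup; first exact: small_option.
  move=> [s|]; apply: small_card_union.
    apply: small_union_setI; first exact: uniform_small_union.
    exact: small_union_setC.
  exact/small_union_setC/small_union_bigcup.
have := uniform_setI uD (uniform_comp (fun _ : S => tt) sA).
apply: uniform_eq => s /=; apply/seteqP; split=> x.
  by move=> [xD [t _ xt]]; rewrite (disjD _ _ _ xD (BD _ _ xt)).
by move=> xB; split; [apply: BD | exists s].
Qed.

(** After the members of the family have been made disjoint along a well-order
    of the indices, the traces of [B] on them have a common bound by
    [uniform_disjoint], so that their union is still a small union. *)
Lemma null_bigcup (S : Type) (D : S -> set X) : small k S -> uniform D ->
  (forall s, null (D s)) -> null (\bigcup_s D s).
Proof.
have [o oS] := ex_wo S; case: S / oS D => D ko uD nD B cB BD.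
pose D' s := D s `&` \bigcap_t (if wlt t s then ~` D t else setT).
have D'P s x : D' s x <-> D s x /\ forall t, wlt t s -> ~ D t x.
  split=> -[xs xP]; split=> // t; first by move=> ts; have := xP t Logic.I; rewrite ts.
  by move=> _; case: ifP => // /xP.
have uD' : uniform D'.
  apply: uniform_setI => //; apply: uniform_bigcap => //.
  apply: (@uniform_cases _ (fun p : o * o => wlt p.2 p.1) (fun p => ~` D p.2)
    (fun=> setT)); last exact: uniform_setT.
    by move=> [s t] /=; case: ifP => _; [left|right].
  exact: uniform_setC (uniform_comp snd uD).
have uBD : uniform (fun s => B `&` D' s).
  apply: (uniform_disjoint ko uD').
  - move=> s t x /D'P[xs sP] /D'P[xt tP]; apply: contrapT => /wlt_neq[/tP|/sP] //.
  - move=> s; apply: (nD s) => [|x [_ /D'P[]] //].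
    by apply: card_union_setI => //; apply: uniform_small_union.
  - by move=> s x [].
have -> : B = \bigcup_s (B `&` D' s).
  apply/seteqP; split=> [x xB|x [s _ []] //].
  have [|s [xs smin]] := @wle_min o (fun s => D s x).
    by have [s _ xs] := BD x xB; exists s.
  exists s => //; split=> //; apply/D'P; split=> // t ts xt.
  by move: ts; rewrite wltNge smin.
exact: small_union_bigcup.
Qed.

Lemma null_setU (D E : set X) : small_union D -> small_union E ->
  null D -> null E -> null (D `|` E).
Proof.
move=> sD sE nD nE.
apply: (@null_sub _ (\bigcup_(b : bool) if b then D else E)).
  by move=> x [xD|xE]; [exists true|exists false].
apply: null_bigcup; [exact: small_bool| |by case].
apply: (@uniform_cases _ (fun b : bool => b) (fun=> D) (fun=> E)).
- by move=> []; [left|right].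
- exact: uniform_comp (fun=> tt) sD.
- exact: uniform_comp (fun=> tt) sE.
Qed.

(** A set that is not null contains small unions needing arbitrarily many
    pieces. Choosing inside the [j]-th set one that needs more than [f j]
    pieces, where [f] is cofinal in [k], contradicts the common bound given by
    [uniform_disjoint]. *)
Lemma no_disjoint_nonnull (D : cof k -> set X) : uniform D ->
    (forall s t x, D s x -> D t x -> s = t) ->
  ~ (forall j, ~ null (D j)).
Proof.
move=> uD disjD nnD; have [f fP] := cof_cofinal k.
have /choice[B BP] (j : cof k) : exists B, [/\ small_union B, B `<=` D j &
    ~ exists2 F : below (f j) -> set X, (forall y, P (F y)) & B = \bigcup_y F y].
  apply: contrapT => /forallNP nB; apply: (nnD j) => A cA AD.
  have [L sL AL] := card_union_cof cA.
  have /choice[F FP] (i : cof k) : exists F : below (f j) -> set X,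
      (forall y, P (F y)) /\ L i = \bigcup_y F y.
    apply: contrapT => nF; apply: (nB (L i)); split=> //.
      by move=> x xL; apply: AD; rewrite AL; exists i.
    by move=> [F PF LF]; apply: nF; exists F.
  apply/small_unionP; exists (cof k * below (f j))%type.
    by apply: small_prod => //; [apply: small_cof|apply: small_below].
  exists (fun p => F p.1 p.2) => [p|]; first exact: (proj1 (FP p.1)).
  rewrite AL; apply/seteqP; split=> x.
    by move=> [i _]; rewrite (proj2 (FP i)) => -[y _ xy]; exists (i, y).
  by move=> [[i y] _ xy]; exists i => //; rewrite (proj2 (FP i)); exists y.
have [E kE [F PF BF]] : uniform B.
  by apply: (uniform_disjoint (small_cof k_sing) uD disjD) => s; have [] := BP s.
have [x Ex] := small_emb_below k_card kE; have [j xj] := fP x.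
have Ej : emb E (below (f j)).
  apply: emb_trans Ex _.
  by exists (fun y => exist _ (sval y) (wle_trans (proj2_sig y) xj) : below (f j))
    => y z [/sval_inj].
have [_ _] := BP j; apply; rewrite BF.
by have [G PG ->] := bigcup_pad P_set0 (PF j) Ej; exists G.
Qed.

(* The role of [b] is played by a basis of open sets enumerated by [k]. *)
Variable b : k -> set X.
Hypothesis uniform_open : uniform (fun U : set k => \bigcup_(l in U) b l).
Hypothesis P_set1 : forall x, P [set x].
Hypothesis b_separates : forall x, exists2 C : cof k -> set X,
  uniform C & ~` [set x] `<=` \bigcup_i C i /\
  forall i, exists2 l, b l x & C i `<=` ~` b l.

Lemma uniform_b : uniform b.
Proof.
apply: uniform_eq (uniform_comp (fun l : k => [set l]) uniform_open) => l /=.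
by rewrite bigcup_set1.
Qed.

Lemma null_set1 x : null [set x].
Proof.
by move=> B _ /subset_set1[]->; apply: small_union_class.
Qed.

(** Suppose that no [b l] splits [D]. The union of the null traces of basic
    sets on [D] is null, so some [x] of [D] is left over. Each piece [C i] of
    the complement of [x] misses a basic set around [x], whose trace on [D] is
    not null, so the trace of [C i] must be null. Thus [D] is null. *)
Lemma nonnull_split (D : set X) : small_union D -> ~ null D ->
  exists l, ~ null (D `&` b l) /\ ~ null (D `&` ~` b l).
Proof.
move=> sD nnD; apply: contrapT => /forallNP nsplit.
have uDs (I : Type) : uniform (fun _ : I => D) := uniform_comp (fun=> tt) sD.
have ubs (I : Type) (h : I -> k) : uniform (fun i => b (h i)) :=
  uniform_comp h uniform_b.
have [f fP] := cof_cofinal k.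
pose O (U : set k) := \bigcup_(l in U) b l.
pose U := [set l | null (D `&` b l)].
pose W j := U `&` [set l | wle l (f j)].
(* The null traces are gathered first below each [f j], then over [j]: both
   steps are small unions. *)
have nW j : null (D `&` O (W j)).
  pose I := {y : below (f j) | U (sval y)}.
  apply: (@null_sub _ (\bigcup_(y : I) (D `&` b (sval (sval y))))).
    move=> x [xD [l [Ul lj] xl]].
    by exists (exist (fun y : below (f j) => U (sval y)) (exist _ l lj) Ul).
  apply: null_bigcup => [||[y Uy] //]; first exact/small_sig/small_below.
  exact: uniform_setI (uDs _) (ubs _ _).
have nU : null (D `&` O U).
  apply: (@null_sub _ (\bigcup_j (D `&` O (W j)))).
    move=> x [xD [l Ul xl]]; have [j lj] := fP l.
    by exists j => //; split=> //; exists l.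
  apply: null_bigcup => //; first exact: small_cof.
  exact: uniform_setI (uDs _) (uniform_comp W uniform_open).
have sU : small_union (D `&` O U).
  by apply: small_union_setI => //; apply: (uniform_small_union U uniform_open).
have [[x [xD xU]]|nx] := pselect (exists x, D x /\ ~ O U x); last first.
  apply: nnD; apply: null_sub nU => x xD; split=> //.
  by apply: contrapT => xU; apply: nx; exists x.
have [C uC [xC Cb]] := b_separates x.
have nC i : null (D `&` C i).
  have [l xl Cl] := Cb i.
  have nbl : ~ null (D `&` b l) by move=> nl; apply: xU; exists l.
  apply: (@null_sub _ (D `&` ~` b l)) => [y [yD /Cl] //|].
  by apply: contrapT => nl; apply: (nsplit l).
have uDC : uniform (fun i => D `&` C i) by apply: uniform_setI.
apply: nnD; apply: (@null_sub _ ((\bigcup_i (D `&` C i)) `|` [set x])).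
  move=> y yD; have [->|yx] := pselect (y = x); first by right.
  by left; have [//|i _ yi] := xC y; exists i.
apply: null_setU; last exact: null_set1.
- by apply: small_union_bigcup => //; apply: small_cof.
- exact: small_union_class.
- by apply: null_bigcup => //; apply: small_cof.
Qed.

(** [T x j] is the cell containing [x] after [j] splittings, each cell being
    split by the basic set that [l] assigns to it. *)
Lemma null_setT : null setT.
Proof.
apply: contrapT => nnT.
have [x0 _] : exists x : X, True.
  apply: contrapT => nX; apply: nnT => B _ _.
  have -> : B = set0 by apply/seteqP; split=> // x; case: nX; exists x.
  exact: small_union_class.
have [l0 _] := nonnull_split (uniform_small_union tt (@uniform_setT unit)) nnT.
have /choice[l lP] (D : set X) : exists l, small_union D -> ~ null D ->
    ~ null (D `&` b l) /\ ~ null (D `&` ~` b l).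
  have [[sD nD]|nD] := pselect (small_union D /\ ~ null D).
    by have [l lP] := nonnull_split sD nD; exists l.
  by exists l0 => sD nD'; case: nD.
pose step (x : X) (j : cof k) (T : forall i, wlt i j -> set X) : set X :=
  [set y | forall i (ij : wlt i j), b (l (T i ij)) y <-> b (l (T i ij)) x].
pose T x j := Fix (@wlt_wf (cof k)) (fun _ => set X) (step x) j.
have TE x j : T x j =
    [set y | forall i, wlt i j -> (b (l (T x i)) y <-> b (l (T x i)) x)].
  rewrite /T Fix_eq // => i g h gh; congr (step x i _).
  by apply/functional_extensionality_dep => t; apply/funext => ti.
pose side (p : X * cof k) := [set y | b (l (T p.1 p.2)) y <-> b (l (T p.1 p.2)) p.1].
have ub : uniform (fun p : X * cof k => b (l (T p.1 p.2))).
  exact: uniform_comp (fun p => l (T p.1 p.2)) uniform_b.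
have uside : uniform side.
  apply: (uniform_cases (b := fun p => b (l (T p.1 p.2)) p.1) _ ub (uniform_setC ub)).
  move=> p; have [bp|nbp] := pselect (b (l (T p.1 p.2)) p.1); [left|right]; split=> //;
    by apply/seteqP; split=> y; rewrite /side /=; tauto.
have uT : uniform (fun p : X * cof k => T p.1 p.2).
  pose D (p : X * cof k) i := if wlt i p.2 then side (p.1, i) else setT.
  have uD : uniform (fun q : (X * cof k) * cof k => D q.1 q.2).
    apply: (uniform_cases (b := fun q => wlt q.2 q.1.2)
      (D1 := fun q => side (q.1.1, q.2)) (D2 := fun=> setT));
      last exact: uniform_setT.
      by move=> q; rewrite /D; case: ifP => _; [left|right].
    exact: uniform_comp (fun q : (X * cof k) * cof k => (q.1.1, q.2)) uside.
  apply: uniform_eq (uniform_bigcap (small_cof k_sing) uD) => -[x j] /=.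
  rewrite TE; apply/seteqP; split=> y.
    by move=> yD i ij; have := yD i Logic.I; rewrite /D /= ij.
  by move=> yT i _; rewrite /D /=; case: ifP => // ij; apply: yT.
(* A cell is determined by the sequence of sides on which its points fall, so
   the cells form a small family. *)
pose code x (j : cof k) := `[< b (l (T x j)) x >].
have codeT x x' : code x = code x' -> forall j, T x j = T x' j.
  move=> cxx' j; elim/wlt_ind: j => j IH; rewrite !TE.
  have bxx' i : b (l (T x i)) x <-> b (l (T x' i)) x'.
    exact: asbool_eq_equiv (congr1 (fun h => h i) cxx').
  by apply/seteqP; split=> y yP i ij; move: (yP i ij) (bxx' i); rewrite IH //; tauto.
have /choice[g gP] (s : cof k -> bool) : exists x, (exists x, code x = s) -> code x = s.
  by have [[x xs]|ns] := pselect (exists x, code x = s); [exists x | exists x0].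
have [x xP] : exists x, forall j, ~ null (T x j).
  apply: contrapT => /forallNP nx.
  pose Q (p : (cof k -> bool) * cof k) := null (T (g p.1) p.2).
  apply: nnT.
  apply: (@null_sub _ (\bigcup_(q : {p | Q p}) T (g (sval q).1) (sval q).2)).
    move=> x _; have [j jx] : exists j, null (T x j).
      by apply: contrapT => nj; apply: (nx x) => j jP; apply: nj; exists j.
    have Tg : T (g (code x)) j = T x j by apply: codeT; apply: gP; exists x.
    have Qx : Q (code x, j) by rewrite /Q /= Tg.
    by exists (exist Q _ Qx) => //=; rewrite Tg TE.
  apply: null_bigcup => [||[p Qp] //].
    apply: small_sig; apply: small_prod => //; last exact: small_cof.
    by apply: small_fun => //; [apply: small_cof | apply: small_bool].
  exact: uniform_comp (fun q : {p | Q p} => (g (sval q).1, (sval q).2)) uT.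
(* The halves discarded along the way to [x] are disjoint and nonnull. *)
have uTx : uniform (fun j => T x j) by exact: uniform_comp (fun j => (x, j)) uT.
have usx : uniform (fun j => side (x, j)).
  exact: uniform_comp (fun j => (x, j)) uside.
apply: (@no_disjoint_nonnull (fun j => T x j `&` ~` side (x, j))).
- by apply: uniform_setI => //; apply: uniform_setC.
- have lt_disj i j y : wlt i j -> (T x j `&` ~` side (x, j)) y -> ~ (~` side (x, i)) y.
    by move=> ij [+ _] yi; rewrite TE => /(_ i ij).
  move=> i j y yi yj; apply: contrapT => /wlt_neq[ij|ji].
    by apply: (lt_disj _ _ _ ij yj); case: yi.
  by apply: (lt_disj _ _ _ ji yi); case: yj.
move=> j; have [n1 n2] := lP _ (uniform_small_union j uTx) (xP j).
have [bx|nbx] := pselect (b (l (T x j)) x).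
  move=> nT; apply: n2; apply: null_sub nT => y [yT nby]; split=> // yx.
  exact/nby/(proj2 yx).
move=> nT; apply: n1; apply: null_sub nT => y [yT yb]; split=> // yx.
exact/nbx/(proj1 yx).
Qed.

Lemma card_union_collapse A : card_union A -> small_union A.
Proof. by move=> cA; apply: null_setT. Qed.

End SmallUnions.

(** * The Borel hierarchy with ranks shifted to start at zero *)

Lemma Sigma_eqO (g : Ord) (X : topologicalType) (a a' : Ord) A :
  eqO a a' -> Sigma g X a A -> Sigma g X a' A.
Proof.
move=> [aa' a'a] SA.
case: SA aa' a'a => [{}a U [a1 la] oU aa' a'a|{}a d b F a1 dg b1 ba SF aa' a'a].
  by apply: Sigma_open => //; split; [apply: leO_trans a1|apply: leO_trans aa'].
apply: Sigma_bigcup SF => //; first exact: ltO_le_trans aa'.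
by move=> i; apply: ltO_le_trans aa'.
Qed.

Section Hierarchy.
Variables (k : Ord) (X : topologicalType).
Hypotheses (k_sing : singular_cardinal k) (k_pow : eqO (pow2_lt k) k).
Hypothesis X_open : forall U : set X, open U ->
  exists F : set (set X),
    [/\ F #<= [set: cof k], F `<=` closed & U = \bigcup_(C in F) C].

Let k_card : cardinal k. Proof. by case: k_sing. Qed.
Let k_inf : omegaO <o k. Proof. by case: k_sing. Qed.

Definition Sig (b : Ord) : set (set X) := Sigma k X (natO 1 +o b).

(** The recursion on the shifted rank, with ordinal indices replaced by small
    types: a small type carries a well-order, necessarily shorter than [k]. *)
Lemma SigP b A : Sig b A <-> eqO b (natO 0) /\ open A \/
  natO 0 <o b /\ exists2 I : Type, small k I & exists2 F : I -> set X,
    (forall i, exists2 c, c <o b & Sig c (~` F i)) & A = \bigcup_i F i.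
Proof.
have gt1 : natO 1 <o natO 1 +o b <-> natO 0 <o b.
  rewrite gtO_natO0 -addO1_eq1; split=> [lt [le _]|ne]; first exact: leO_not_gt le lt.
  split=> [|le]; first exact: addO1_ge1.
  by apply: ne; split=> //; apply: addO1_ge1.
split=> [|[[b0 oA]|[b_gt0 [I kI [F SF ->]]]]]; last 1 first.
- have [d dk dI] := (smallP k_card I).1 kI; case: I / dI kI F SF => kd F SF.
  have /choice[c cP] (i : d) : exists c, c <o b /\ Sig c (~` F i).
    by have [c] := SF i; exists c.
  apply: (@Sigma_bigcup k X _ d (fun i => natO 1 +o c i) F) => //.
  + exact/gt1.
  + by move=> i; apply: addO1_ge1.
  + by move=> i; apply/addO1_lt; apply: (proj1 (cP i)).
  + by move=> i; apply: (proj2 (cP i)).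
- move=> SbA; have [a ea SA] : exists2 a, eqO a (natO 1 +o b) & Sigma k X a A.
    by exists (natO 1 +o b) => //; apply: eqO_refl.
  clear SbA.
  case: SA ea => [{}a U a1 oU ea|{}a d c F a1 dk c1 ca SF ea].
    by left; split=> //; apply/addO1_eq1; apply: eqO_trans a1; apply: eqO_sym.
  right; split; first by apply/gt1; apply: ltO_le_trans a1 _; case: ea.
  exists d; first exact: small_lt.
  exists F => // i; have [e ce] := ge1_addO1 (c1 i).
  exists e; last exact: Sigma_eqO (SF i).
  apply/addO1_lt; have [_ /leO_lt_trans] := ce; apply.
  by apply: ltO_le_trans (ca i) _; case: ea.
- by apply: Sigma_open => //; apply/addO1_eq1.
Qed.

Lemma Sig_open0 b U : eqO b (natO 0) -> open U -> Sig b U.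
Proof. by move=> b0 oU; apply/SigP; left. Qed.

Lemma Sig_union b (I : Type) (F : I -> set X) : natO 0 <o b -> small k I ->
  (forall i, exists2 c, c <o b & Sig c (~` F i)) -> Sig b (\bigcup_i F i).
Proof. by move=> b0 kI SF; apply/SigP; right; split=> //; exists I => //; exists F. Qed.

Lemma Sig_eqO b c : eqO b c -> Sig b = Sig c.
Proof.
move=> bc; have bc1 : eqO (natO 1 +o b) (natO 1 +o c).
  by case: bc => ? ?; split; apply/addO1_le.
by apply/seteqP; split=> A; apply: Sigma_eqO => //; apply: eqO_sym.
Qed.

Lemma cof_closed_union U : open U ->
  exists2 C : cof k -> set X, (forall i, closed (C i)) & U = \bigcup_i C i.
Proof.
move=> /X_open[F [/card_le_emb Fk Fcl ->]].
have Fc : emb F (cof k) by apply: emb_trans Fk _; apply: emb_sig.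
have Fcl' (A : F) : closed (val A) by apply: Fcl; apply: set_valP.
have [C Ccl CF] := bigcup_pad closed0 Fcl' Fc.
by exists C => //; rewrite -CF bigcup_set_type.
Qed.

Lemma ltO_gt0 b c : b <o c -> natO 0 <o c.
Proof. exact: leO_lt_trans (natO0_le b). Qed.

(** The only case that is not formal is that of open sets, which are small
    unions of closed sets by the assumption on the space. *)
Lemma Sig_mono b c A : b <=o c -> Sig b A -> Sig c A.
Proof.
move=> bc; have [c0|c0] := eqO_natO0_or_gt c.
  have -> // : Sig b = Sig c; apply: Sig_eqO; split=> //.
  by apply: leO_trans (natO0_le b); case: c0.
move=> /SigP[[b0 /cof_closed_union[C Ccl ->]]|[b0 [I kI [F SF ->]]]].
  apply: Sig_union => //; first exact: small_cof.
  move=> i; exists (natO 0) => //; apply: Sig_open0 (eqO_refl _) _.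
  exact: closed_openC.
apply: Sig_union => // i; have [d db Sd] := SF i.
by exists d => //; apply: ltO_le_trans bc.
Qed.

Lemma Sig_setC b c A : b <o c -> Sig b A -> Sig c (~` A).
Proof.
move=> bc SA; have -> : ~` A = \bigcup_(_ : unit) ~` A.
  by apply/seteqP; split=> [x xA|x [_ _]]; [exists tt|].
apply: Sig_union; [exact: ltO_gt0 bc|exact: small_unit|].
by move=> _; exists b => //; rewrite setCK.
Qed.

Lemma Sig_open b U : open U -> Sig b U.
Proof.
by move=> oU; apply: Sig_mono (natO0_le b) _; apply: Sig_open0 (eqO_refl _) oU.
Qed.

Lemma Sig_setC_closed b U : closed U -> Sig b (~` U).
Proof. by move=> cU; apply/Sig_open/closed_openC. Qed.

Lemma Sig_setT b : Sig b setT. Proof. exact/Sig_open/openT. Qed.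
Lemma Sig_set0 b : Sig b set0. Proof. exact/Sig_open/open0. Qed.

Definition coSig (b : Ord) : set (set X) := [set A | Sig b (~` A)].

Lemma coSig_set0 b : coSig b set0.
Proof. by rewrite /coSig /= setC0; apply: Sig_setT. Qed.

Lemma Sig_succ b A : Sig (b +o natO 1) A <-> small_union k (coSig b) A.
Proof.
split=> [/SigP[[[b0 _] _]|[_ [I kI [F SF ->]]]]|/small_unionP[I kI [F SF ->]]].
- exfalso; apply: (leO_not_gt b0); apply: leO_lt_trans (natO0_le b) _.
  exact: succO_gt.
- apply/small_unionP; exists I => //; exists F => // i.
  by have [c /ltO_succ cb Sc] := SF i; apply: Sig_mono Sc.
- apply: Sig_union => //; first exact: ltO_gt0 (succO_gt b).
  by move=> i; exists b; [apply: succO_gt|apply: SF].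
Qed.

(** * The ranks of the even kind *)

Definition selfdual (C : set (set X)) := forall A, C A -> C (~` A).

Definition small_union_closed (C : set (set X)) :=
  forall (I : Type) (F : I -> set X), small k I -> (forall i, C (F i)) ->
    C (\bigcup_i F i).

(** In the second condition [N] does not depend on the set [A]; without such a
    uniform bound the distributive law could not be used at the next rank. *)
Definition even_like (b : Ord) : Prop := small_union_closed (Sig b) /\
  exists2 N : Type, small k N & forall A, Sig b A -> exists2 G : N -> set X,
    (forall n, coSig b (G n)) & A = \bigcup_n G n.

Lemma even_like_eqO b c : eqO b c -> even_like b -> even_like c.
Proof. by move=> /Sig_eqO; rewrite /even_like /coSig => ->. Qed.

Lemma coSig_bigcap b : small_union_closed (Sig b) ->
  forall (I : Type) (F : I -> set X), small k I ->
  (forall i, coSig b (F i)) -> coSig b (\bigcap_i F i).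
Proof. by move=> Sb I F kI SF; rewrite /coSig /= setC_bigcap; apply: Sb. Qed.

Lemma coSig_compl b N :
    (forall A, Sig b A -> exists2 G : N -> set X,
      (forall n, coSig b (G n)) & A = \bigcup_n G n) ->
  forall A, coSig b A -> exists2 G : N -> set X,
      (forall n, coSig b (G n)) & ~` A = \bigcup_n G n.
Proof. by move=> Sb A; apply: Sb. Qed.

(** Sets of rank one more are small unions of members of the dual class, and
    these are complemented by distributivity. *)
Lemma selfdual_succ b : even_like b -> selfdual (Sig (b +o natO 1)).
Proof.
move=> [Sb [N kN SN]] A; rewrite !Sig_succ.
exact: (small_union_setC k_sing k_pow (coSig_bigcap Sb) kN (coSig_compl SN)).
Qed.

(** By selfduality at the intermediate rank, one takes small unions of small
    unions here; their lengths may be cofinal in [k], and conversely any union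
    of [k] sets splits into cofinality many small ones. *)
Lemma Sig_succ_succ b A : even_like b ->
  Sig (b +o natO 1 +o natO 1) A <-> card_union k (coSig b) A.
Proof.
move=> Eb; have b0 := coSig_set0 b; split.
  move=> /Sig_succ/small_unionP[I kI [F SF ->]].
  apply: card_union_small_bigcup => // i; apply: small_card_union => //.
  by apply/Sig_succ; rewrite -[F i]setCK; apply: selfdual_succ => //; apply: SF.
move=> /(card_union_cof k_sing)[B sB ->].
apply/Sig_succ/small_unionP; exists (cof k); first exact: small_cof.
by exists B => // j; apply: selfdual_succ => //; apply/Sig_succ.
Qed.

Lemma even_like_succ_succ b : even_like b -> even_like (b +o natO 1 +o natO 1).
Proof.
move=> Eb; split=> [I F kI SF|].
  apply/(Sig_succ_succ _ Eb)/card_union_small_bigcup => //; first exact: coSig_set0.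
  by move=> i; apply/(Sig_succ_succ _ Eb).
exists (cof k); first exact: small_cof.
move=> A /(Sig_succ_succ _ Eb)/(card_union_cof k_sing)[B sB AB].
by exists B => // j; apply: Sig_setC (succO_gt _) _; apply/Sig_succ.
Qed.

Lemma even_like_zero b : eqO b (natO 0) -> even_like b.
Proof.
move=> b0; have S0 A : Sig b A -> open A.
  by move=> /SigP[[]//|[/leO_not_gt b_gt0]]; case: b_gt0; case: b0.
split=> [I F kI SF|].
  by apply: Sig_open0 => //; apply: bigcup_open => i _; apply: S0.
exists (cof k); first exact: small_cof.
move=> A /S0/cof_closed_union[C Ccl AC]; exists C => // n.
exact: Sig_setC_closed.
Qed.

(** Cut an injection of [b] into [k] into cofinality many small pieces. If one
    of them is cofinal in [b], it is the family sought; otherwise the family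
    of their bounds is, and it is indexed by the cofinality of [k]. *)
Lemma small_cofinal (b : Ord) : emb b k ->
  exists2 N : Type, small k N & exists2 c : N -> Ord, (forall n, c n <o b) &
    forall a, a <o b -> exists n, a <=o c n.
Proof.
move=> [h hI]; have [f fP] := cof_cofinal k.
have [[j jP]|nj] := pselect (exists j, forall x : b,
    exists2 y, wle (h y) (f j) & wle x y).
  exists {y | wle (h y) (f j)}.
    apply: small_emb (small_below k_card k_inf (x := f j)).
    exists (fun y : {y | wle (h y) (f j)} =>
      exist _ (h (sval y)) (proj2_sig y) : below (f j)).
    by move=> y z [/hI/sval_inj].
  exists (fun y => segO (sval y)) => [y|a /ltO_segO[x [ax _]]]; first exact: segO_lt.
  have [y yj xy] := jP x; exists (exist _ y yj).
  by apply: leO_trans ax _; apply/segO_leP.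
have /choice[x xP] (j : cof k) : exists x, forall y, wle (h y) (f j) -> wlt y x.
  apply: contrapT => /forallNP nx; apply: nj; exists j => x.
  have /existsNP[y /not_implyP[yj /negP]] := nx x.
  by rewrite -wleNgt; exists y.
exists (cof k); first exact: small_cof.
exists (fun j => segO (x j)) => [j|a /ltO_segO[y [ay _]]]; first exact: segO_lt.
have [j yj] := fP (h y); exists j; apply: leO_trans ay _.
exact/segO_leP/wltW/xP.
Qed.

(** Group the pieces of a set of limit rank according to a small cofinal family
    of smaller ranks. Each group has rank below the limit, so both conditions
    hold with the index type of that family. *)
Lemma even_like_limit (b : Ord) : limitO b -> emb b k -> even_like b.
Proof.
move=> lb bk; have [N kN [c cb cP]] := small_cofinal bk.
have [b0 lim] := lb.
have dec A : Sig b A -> exists G : N -> set X,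
    (forall n, exists2 e, e <o b & Sig e (~` G n)) /\ A = \bigcup_n G n.
  move=> /SigP[[/eqO_sym[] _ /leO_not_gt //]|[_ [I kI [F SF ->]]]].
  have /choice[e eP] i : exists e, e <o b /\ Sig e (~` F i).
    by have [e] := SF i; exists e.
  exists (fun n => \bigcup_(i : {i | e i <=o c n}) F (sval i)); split.
    move=> n; exists (c n +o natO 1 +o natO 1); first exact/lim/lim.
    apply: Sig_setC (succO_gt _) _; apply/Sig_succ/small_unionP.
    exists {i | e i <=o c n}; first exact: small_sig.
    by exists (fun i => F (sval i)) => // -[i ic]; apply: Sig_mono ic (proj2 (eP i)).
  apply/seteqP; split=> x.
    move=> [i _ xi]; have [n en] := cP _ (proj1 (eP i)).
    by exists n => //; exists (exist _ i en).
  by move=> [n _ [i _ xi]]; exists (sval i).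
split=> [I F kI SF|].
  have /choice[G GP] i := dec _ (SF i).
  have -> : \bigcup_i F i = \bigcup_(p : I * N) G p.1 p.2.
    apply/seteqP; split=> x.
      by move=> [i _]; rewrite (proj2 (GP i)) => -[n _ xn]; exists (i, n).
    by move=> [[i n] _ xn]; exists i => //; rewrite (proj2 (GP i)); exists n.
  apply: Sig_union => //; first exact: small_prod.
  by move=> p; apply: (proj1 (GP p.1)).
exists N => // A /dec[G [SG AG]]; exists G => // n.
by have [e eb Se] := SG n; apply: Sig_mono (ltO_le eb) Se.
Qed.

Lemma even_like_or_succ (b : Ord) : emb b k ->
  even_like b \/ exists2 c, eqO b (c +o natO 1) & even_like c.
Proof.
elim/ltO_ind: b => b IH bk; have [b0|[c bc]|lb] := ord_cases b.
- by left; apply: even_like_zero.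
- have cb : c <o b by apply: ltO_le_trans (succO_gt c) _; case: bc.
  have [Ec|[d cd Ed]] := IH c cb (emb_trans (emb_leO (ltO_le cb)) bk).
    by right; exists c.
  left; apply: even_like_eqO (even_like_succ_succ Ed).
  by apply: eqO_trans (eqO_sym bc); apply: succO_mono; apply: eqO_sym.
- by left; apply: even_like_limit.
Qed.

Lemma evenO_even_like (b : Ord) : emb b k -> evenO b -> even_like b.
Proof.
move=> bk [l [n [l0 n_even bln]]].
have lb : l <=o b.
  by apply: leO_trans (proj2 bln); apply: (@mono_leO l (l +o natO n) inl).
have El : even_like l.
  case: l0 => [|ll]; first exact: even_like_zero.
  by apply: even_like_limit => //; apply: emb_trans (emb_leO lb) bk.
apply: even_like_eqO (eqO_sym bln) _.
rewrite -[n]odd_double_half (negbTE n_even) add0n.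
elim: n./2 => [|m IH]; first exact: even_like_eqO (eqO_sym (addO0 l)) El.
rewrite doubleS; apply: even_like_eqO (even_like_succ_succ IH); apply: eqO_sym.
by apply: eqO_trans (addO_succ _ _) _; apply/succO_mono/addO_succ.
Qed.

(** * The generated algebra *)

Lemma gamma_algebraP (C : set (set X)) :
  gamma_algebra k C <-> selfdual C /\ small_union_closed C.
Proof.
split=> -[CC CU]; split=> //.
  move=> I F kI CF; have [d dk dI] := (smallP k_card I).1 kI.
  by case: I / dI kI F CF => _ F; apply: CU.
by move=> d dk F CF; apply: CU => //; apply: small_lt.
Qed.

Lemma Bor_algebra : gamma_algebra k (Bor k X).
Proof.
split=> [A BA C [oC CA]|d dk F BF C [oC CA]].
  by apply: (proj1 oC); apply: BA; split.
by apply: (proj2 oC) => // i; apply: BF; split.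
Qed.

Lemma Bor_sub (C : set (set X)) :
  open `<=` C -> gamma_algebra k C -> Bor k X `<=` C.
Proof. by move=> oC CA A; apply. Qed.

Lemma open_Bor : open `<=` Bor k X.
Proof. by move=> U oU C [_]; apply. Qed.

Lemma Sig_Bor b : Sig b `<=` Bor k X.
Proof.
have /gamma_algebraP[BC BU] := Bor_algebra.
elim/ltO_ind: b => b IH A /SigP[[_ /open_Bor //]|[_ [I kI [F SF ->]]]].
apply: BU => // i; have [c cb /(IH _ cb)/BC] := SF i.
by rewrite setCK.
Qed.

Lemma Sig_eq_Bor b : selfdual (Sig b) -> small_union_closed (Sig b) ->
  Sig b = Bor k X.
Proof.
move=> Sd Su; apply/seteqP; split; first exact: Sig_Bor.
by apply: Bor_sub => [U|]; [apply: Sig_open | apply/gamma_algebraP].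
Qed.

(** The sets occurring at some rank form an algebra, as any family of ranks is
    bounded; the ranks of all Borel sets then have a common bound. *)
Lemma ex_Sig_Bor : exists a, Sig a = Bor k X.
Proof.
pose C : set (set X) := [set A | exists a, Sig a A].
have BC : Bor k X `<=` C.
  apply: Bor_sub => [U oU|]; first by exists (natO 0); apply: Sig_open.
  split=> [A [a Sa]|d dk F /choice[a aP]].
    by exists (a +o natO 1); apply: Sig_setC (succO_gt a) Sa.
  have [e ae] := ex_upper_boundO a.
  exists (e +o natO 1); apply: Sig_union.
  - exact: ltO_gt0 (succO_gt e).
  - exact: small_lt.
  - by move=> i; exists e; [apply: succO_gt | apply: Sig_setC (ae i) (aP i)].
have /choice[r rP] (A : set X) : exists a, Bor k X A -> Sig a A.
  have [BA|nBA] := pselect (Bor k X A); last by exists (natO 0).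
  by have [a] := BC A BA; exists a.
have [a ra] := ex_upper_boundO r.
exists a; apply/seteqP; split=> [|A BA]; first exact: Sig_Bor.
exact: Sig_mono (ltO_le (ra A)) (rP A BA).
Qed.

Lemma borel_order_le a : borel_order k X <=o natO 1 +o a <-> Sig a = Bor k X.
Proof.
have [|[o1 oB] omin] := @leastP (fun a => natO 1 <=o a /\ Sigma k X a = Bor k X).
  by have [e eB] := ex_Sig_Bor; exists (natO 1 +o e); split=> //; apply: addO1_ge1.
split=> [oa|Sa]; last by apply: omin; split=> //; apply: addO1_ge1.
have [c oc] := ge1_addO1 o1.
apply/seteqP; split=> [|A]; first exact: Sig_Bor.
rewrite -oB => /(Sigma_eqO oc); apply: Sig_mono.
by apply/addO1_le; apply: leO_trans oa; case: oc.
Qed.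

(** A union of [k] sets is a union of cofinality many small unions. *)
Lemma bigcup_closed_card (C : set (set X)) (d : Ord) : gamma_algebra k C ->
  C set0 -> emb d k -> bigcup_closed d C.
Proof.
move=> /gamma_algebraP[_ CU] C0 dk F CF.
have [G CG ->] := bigcup_pad C0 CF dk.
have [f fP] := cof_cofinal k.
have -> : \bigcup_x G x = \bigcup_j \bigcup_(y : below (f j)) G (sval y).
  apply/seteqP; split=> x.
    by move=> [y _ xy]; have [j yj] := fP y; exists j => //; exists (exist _ y yj).
  by move=> [j _ [y _ xy]]; exists (sval y).
apply: (CU) => [|j]; first exact: small_cof.
by apply: CU => [|y //]; apply: small_below.
Qed.

Lemma bigcap_closedP (C : set (set X)) (d : Ord) :
  bigcap_closed d C <-> bigcup_closed d [set A | C (~` A)].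
Proof.
split=> CC F CF.
  by rewrite /= setC_bigcup; apply: CC.
rewrite -[\bigcap_i _]setCK setC_bigcap; apply: CC => i.
by rewrite /= setCK.
Qed.

Lemma bigcup_closed_emb (C : set (set X)) (d : Ord) : C set0 -> emb d k ->
  bigcup_closed k C -> bigcup_closed d C.
Proof. by move=> C0 dk CU F CF; have [G CG ->] := bigcup_pad C0 CF dk; apply: CU. Qed.

Lemma bigcap_closed_emb (C : set (set X)) (d : Ord) : C setT -> emb d k ->
  bigcap_closed k C -> bigcap_closed d C.
Proof.
move=> CT dk /bigcap_closedP CC; apply/bigcap_closedP.
by apply: bigcup_closed_emb CC => //=; rewrite setC0.
Qed.

End Hierarchy.

(** * From coincidence of classes to the Borel algebra *)

Section Equivalences.
Variables (k : Ord) (X : topologicalType).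
Hypotheses (k_sing : singular_cardinal k) (k_pow : eqO (pow2_lt k) k).
Hypotheses (X_T1 : forall x : X, closed [set x]) (X_weight : weight_le X k).
Hypothesis X_open : forall U : set X, open U ->
  exists F : set (set X),
    [/\ F #<= [set: cof k], F `<=` closed & U = \bigcup_(C in F) C].

Let k_card : cardinal k. Proof. by case: k_sing. Qed.
Let k_inf : omegaO <o k. Proof. by case: k_sing. Qed.

Local Notation S := (@Sig k X).
Local Notation cS := (@coSig k X).

Lemma weight_enumeration : exists b : k -> set X, (forall l, open (b l)) /\
  forall x U, open U -> U x -> exists2 l, b l x & b l `<=` U.
Proof.
have [B /card_le_emb Bk [Bo Bnbhs]] := X_weight.
have BK : emb B k by apply: emb_trans Bk _; apply: emb_sig.
have [b [bB Bb]] := emb_reindex (fun V : B => val V) set0 BK.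
exists b; split=> [l|x U oU Ux].
  by have [->|[V ->]] := Bb l; [apply: open0|apply: Bo; apply: set_valP].
have [V [BV Vx] VU] : filter_from [set V | B V /\ V x] id U.
  by apply: Bnbhs; apply: open_nbhs_nbhs.
have [l lV] := bB (SigSub (mem_set BV) : B).
by exists l; rewrite lV.
Qed.

(** [card_union_collapse] for the dual class of rank [c] and a basis: one rank
    later the sets are its small unions, two ranks later its unions of [k]
    members. *)
Lemma odd_collapse c : even_like k X c ->
    (forall A, S (c +o natO 1 +o natO 1) A -> S (c +o natO 1 +o natO 1) (~` A) ->
       S (c +o natO 1) A) ->
  small_union_closed k (S (c +o natO 1)).
Proof.
move=> Ec amb; have [Sc [N kN SN]] := Ec.
have c0 : cS c set0 by apply: coSig_set0.
have cap := coSig_bigcap Sc.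
have compl := coSig_compl SN.
have amb' A : card_union k (cS c) A -> card_union k (cS c) (~` A) ->
    small_union k (cS c) A.
  move=> cA cA'; apply/Sig_succ => //; apply: amb; exact/Sig_succ_succ.
have [b [bo bP]] := weight_enumeration.
have cC C : closed C -> cS c C by move=> Ccl; apply: Sig_setC_closed.
have uo : uniform k (cS c) (fun U : set k => \bigcup_(l in U) b l).
  have uc : uniform k (cS c) (fun U : set k => ~` \bigcup_(l in U) b l).
    apply: uniform_class => // U; apply/cC/open_closedC.
    by apply: bigcup_open => l _; apply: bo.
  apply: uniform_eq (uniform_setC k_sing k_pow cap kN compl uc) => U.
  by rewrite setCK.
have sep x : exists2 C : cof k -> set X, uniform k (cS c) C &
    ~` [set x] `<=` \bigcup_i C i /\ forall i, exists2 l, b l x & C i `<=` ~` b l.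
  have [C Ccl xC] := cof_closed_union X_open (closed_openC (@X_T1 x)).
  exists C; first by apply: uniform_class => // i; apply: cC.
  split=> [|i]; first by rewrite xC.
  have [|l lx lC] := bP x _ (closed_openC (Ccl i)).
    by move=> Cx; have /(_ erefl) : (~` [set x]) x by rewrite xC; exists i.
  by exists l => // y Cy /lC.
have coll := card_union_collapse k_sing k_pow c0 cap kN compl amb' uo
  (fun x => cC _ (@X_T1 x)) sep.
move=> I F kI SF; apply/Sig_succ/coll => //.
apply: card_union_small_bigcup => // i; apply: small_card_union => //.
exact/Sig_succ.
Qed.

Variable a : Ord.
Hypothesis a_card : emb a k.

Lemma even_selfdual_Bor : even_like k X a -> selfdual (S a) -> S a = Bor k X.
Proof. by move=> [Su _] Sd; apply: Sig_eq_Bor. Qed.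

(** At a rank of the even kind selfduality is enough; one rank later, where
    selfduality is automatic, the collapse applies. *)
Lemma selfdual_ambiguous_Bor : selfdual (S a) ->
    (forall A, S (a +o natO 1) A -> S (a +o natO 1) (~` A) -> S a A) ->
  S a = Bor k X.
Proof.
move=> Sd amb.
have [Ea|[c ac Ec]] := even_like_or_succ k_sing k_pow X_open a_card.
  exact: even_selfdual_Bor.
apply: Sig_eq_Bor => //.
rewrite (Sig_eqO k X ac); apply: odd_collapse => // A.
by rewrite -(Sig_eqO k X ac) -(Sig_eqO k X (succO_mono ac)); apply: amb.
Qed.

Lemma dual_bounded_Bor b : a <o b -> selfdual (S a) ->
  (forall A, S b A -> S a A) -> S a = Bor k X.
Proof.
move=> ab Sd Sba; apply: Sig_eq_Bor => // I F kI SF.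
apply: Sba; apply: (Sig_mono k_sing X_open (proj1 (succO_le _ _) ab)).
apply/Sig_succ => //.
by apply/small_unionP; exists I => //; exists F => // i; apply: Sd.
Qed.

(** How a class of rank [a] that coincides with one of higher rank is used: the
    latter contains both Sigma and Pi of rank [a]. *)
Lemma sandwich_selfdual (C : set (set X)) :
    C `<=` S a \/ C `<=` cS a -> S a `<=` C -> cS a `<=` C ->
  selfdual (S a) /\ C `<=` S a.
Proof.
have SC A : S a A -> cS a (~` A) by rewrite /coSig /= setCK.
move=> Ca SaC cSaC.
have Sd : selfdual (S a).
  by move=> A SA; case: Ca => CS; [apply/CS/cSaC/SC | apply: (CS); apply: SaC].
split=> //; case: Ca => // CS A /CS cA; rewrite -[A]setCK; exact: Sd.
Qed.

End Equivalences.

(** * The equivalent conditions *)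

Theorem proposition5p7 (kappa : Ord) (X : topologicalType)
    (kappa_singular : singular_cardinal kappa)
    (kappa_pow : eqO (pow2_lt kappa) kappa)
    (X_nonempty : [set: X] !=set0)
    (X_regular : regular_space X)
    (X_hausdorff : hausdorff_space X)
    (X_weight : weight_le X kappa)
    (X_open : forall U : set X, open U ->
       exists F : set (set X),
         [/\ F #<= [set: cof kappa], F `<=` closed & U = \bigcup_(C in F) C])
    (alpha : Ord) (alpha_lt : alpha <o succ_card kappa) :
  let S b := Sigma kappa X (natO 1 +o b) in
  let P b := Pi kappa X (natO 1 +o b) in
  let D b := Delta kappa X (natO 1 +o b) in
  let B := Bor kappa X in
  let c1 := borel_order kappa X <=o natO 1 +o alpha in
  let c2 := forall b, alpha <=o b -> [/\ S b = P b, P b = D b & D b = B] in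
  let c3 := exists2 b, alpha <o b &
    exists C E : set (set X), [/\ [\/ C = S alpha, C = P alpha | C = D alpha],
                                  E = S b \/ E = P b & C = E] in
  let c4 := bigcap_closed kappa (S alpha) in
  let c4' := bigcup_closed kappa (P alpha) in
  let c5 := forall d, d <o kappa -> bigcap_closed d (S alpha) in
  let c5' := forall d, d <o kappa -> bigcup_closed d (P alpha) in
  let c6 := exists2 b, alpha <o b &
    [\/ S alpha = D b, P alpha = D b | D alpha = D b] in
  let c7 := bigcap_closed kappa (D alpha) in
  let c8 := forall d, d <o kappa -> bigcap_closed d (D alpha) in
  let c9 := S alpha = P alpha in
  [/\ [<-> c1; c2; c3; c4; c4'; c5; c5'; c6],
      natO 1 <=o alpha ->
        [/\ [<-> c1; c7; c8],
            c7 -> gamma_algebra (succ_card kappa) (D alpha)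
          & c8 -> gamma_algebra kappa (D alpha)]
    & evenO alpha -> (c1 <-> c9)].
Proof.
move=> S P D B c1 c2 c3 c4 c4' c5 c5' c6 c7 c8 c9.
have k_card : cardinal kappa by case: kappa_singular.
have T1 := accessible_closed_set1 (hausdorff_accessible X_hausdorff).
have ak : emb alpha kappa := emb_succ_card k_card alpha_lt.
have mono b c A : b <=o c -> S b A -> S c A by apply: Sig_mono.
have compl b c A : b <o c -> S b A -> S c (~` A) by apply: Sig_setC.
have SPD b : alpha <o b -> S alpha `<=` D b /\ P alpha `<=` D b.
  move=> ab; split=> A SA; split; rewrite /Pi /=.
  - exact: mono (ltO_le ab) SA.
  - exact: compl ab SA.
  - by rewrite -[A]setCK; apply: compl ab SA.
  - exact: mono (ltO_le ab) SA.
have c1E : c1 <-> S alpha = B by apply: borel_order_le.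
have Balg : gamma_algebra kappa B by apply: Bor_algebra.
have [Bd _] := (gamma_algebraP kappa_singular B).1 Balg.
have SB b : S b `<=` B by apply: Sig_Bor.
have all_Bor b : alpha <=o b -> S alpha = B -> [/\ S b = B, P b = B & D b = B].
  move=> ab SaB.
  have Sb : S b = B.
    by apply/seteqP; split=> [|A]; [exact: SB | rewrite -SaB; apply: mono].
  have Pb : P b = B.
    apply/seteqP; split=> A; rewrite /P /Pi /= -/(S b _) Sb; last exact: Bd.
    by move=> /Bd; rewrite setCK.
  by split=> //; rewrite /D /Delta -/(S b) -/(P b) Sb Pb setIid.
have ST b : S b setT by apply: Sig_setT.
have S0 b : S b set0 by apply: Sig_set0.
have B_bigcap (d : Ord) : emb d kappa -> bigcap_closed d B.
  move=> dk; apply/bigcap_closedP.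
  have -> : [set A | B (~` A)] = B.
    by apply/seteqP; split=> A /Bd //; rewrite /= ?setCK.
  by apply: (bigcup_closed_card kappa_singular Balg) => //; apply: SB (S0 alpha).
have DC A : D alpha A -> D alpha (~` A).
  by move=> [SA PA]; split=> //; rewrite /Pi /= setCK.
have lt_emb (d : Ord) : d <o kappa -> emb d kappa.
  by move=> dk; apply: emb_leO (ltO_le dk).
have DT : D alpha setT.
  by split; [exact: ST | rewrite /Pi /= setCT; apply: S0].
have c8_alg : c8 -> gamma_algebra kappa (D alpha).
  move=> H8; split=> // d dk F DF.
  rewrite -[\bigcup_i _]setCK setC_bigcup; apply/DC/H8 => // i.
  exact/DC/DF.
split.
- tfae.
  + by move=> /c1E SaB b ab; have [-> -> ->] := all_Bor _ ab SaB.
  + move=> H2; exists (alpha +o natO 1); first exact: succO_gt.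
    exists (S alpha), (S (alpha +o natO 1)); split; [exact: Or31|by left|].
    have [e1 e2 e3] := H2 _ (leO_refl alpha).
    have [f1 f2 f3] := H2 _ (ltO_le (succO_gt alpha)).
    by rewrite e1 e2 e3 f1 f2 f3.
  + move=> [b ab [C [E [Ca Eb CE]]]].
    have [SD PD] := SPD b ab.
    have [Sd CS] : selfdual (S alpha) /\ C `<=` S alpha.
      apply: sandwich_selfdual.
      * by case: Ca => ->; [left|right|left] => A //; case.
      * by rewrite CE => A /SD[]; case: Eb => ->.
      * by rewrite CE => A /PD[]; case: Eb => ->.
    have SaB : S alpha = B.
      apply: (@dual_bounded_Bor kappa X _ _ _ b) => // A SA.
      case: Eb => Eb; first by apply: CS; rewrite CE Eb.
      rewrite -[A]setCK; apply/Sd/CS; rewrite CE Eb /P /Pi /=.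
      by rewrite setCK.
    by rewrite /c4 SaB; apply: B_bigcap; apply: emb_refl.
  + by move=> /bigcap_closedP.
  + move=> H4 d dk; apply: bigcap_closed_emb (lt_emb _ dk) _ => //.
    exact/bigcap_closedP.
  + by move=> H5 d dk; apply/bigcap_closedP/H5.
  + move=> H5; exists (alpha +o natO 1); first exact: succO_gt.
    apply: Or32; apply/seteqP; split=> [|A [SA _]].
      exact: (proj2 (SPD _ (succO_gt alpha))).
    have /small_unionP[I kI [F SF ->]] : small_union kappa (coSig kappa alpha) A.
      exact/Sig_succ.
    have [d dk dI] := (smallP k_card I).1 kI.
    by case: I / dI kI F SF => _ F SF; apply: H5.
  + move=> [b ab bD]; have [SD PD] := SPD b ab; apply/c1E.
    have DbC A : D b A -> D b (~` A).
      by move=> [SA PA]; split=> //; rewrite /Pi /= setCK.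
    have Sd : selfdual (S alpha).
      case: bD => e A SA.
      * by move/SD/DbC: SA; rewrite -e.
      * by move/SD: SA; rewrite -e.
      * by move/SD: SA; rewrite -e => -[].
    have DS A : D b A -> S alpha A.
      case: bD => <- //; last by case.
      by move=> /Sd; rewrite setCK.
    apply: selfdual_ambiguous_Bor => // A S1 S2; apply: DS.
    have le : alpha +o natO 1 <=o b by apply/succO_le.
    by split; apply: mono le _.
- move=> a1; split=> //.
  + tfae.
    * move=> /c1E SaB; have [_ _ DB] := all_Bor _ (leO_refl alpha) SaB.
      by rewrite /c7 DB; apply: B_bigcap; apply: emb_refl.
    * by move=> H7 d dk; apply: bigcap_closed_emb (lt_emb _ dk) _.
    * move=> /c8_alg Dalg; apply/c1E/seteqP; split; first exact: SB.
      move=> A BA; have [//] : D alpha A; apply: Bor_sub BA => // U oU.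
      have a0 : natO 0 <o alpha.
        apply: ltO_le_trans a1; split; first exact: natO0_le.
        by move=> /leO_mono[f _]; case: (f ord0).
      split; first exact: Sig_open.
      by apply: compl a0 _; apply: Sig_open.
  + move=> H7; split=> // d dlt F DF.
    rewrite -[\bigcup_i _]setCK setC_bigcup; apply: (DC).
    apply: (bigcap_closed_emb DT (emb_succ_card k_card dlt) H7) => i.
    exact/DC/DF.
- move=> ev; split=> [/c1E SaB|H9].
    by have [e1 e2 _] := all_Bor _ (leO_refl alpha) SaB; rewrite /c9 e1 e2.
  apply/c1E; apply: even_selfdual_Bor => //; first exact: evenO_even_like.
  by move=> A SA; have : P alpha A by rewrite -H9.
Qed.
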